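(* Let $\alpha\in(0,2)$, let $L=(L(x))_{x\in\mathbb{R}}$ be a càdlàg symmetric $\alpha$-stable Lévy process with filtration $(\mathcal{F}_x)_{x\in\mathbb{R}}$, and let $H=(H(x))_{x\in\mathbb{R}}$ be a jointly measurable, $(\mathcal{F}_x)$-adapted stochastic process such that $\mathbb{P}(\forall x\in\mathbb{R}:\underline{H}\le H(x)\le\overline{H})=1$ for some constants $0<\underline{H}\le\overline{H}<1$. Assume: (A) there is a deterministic continuous increasing function $w:\mathbb{R}_{\ge0}\to\mathbb{R}_{\ge0}$ with $w(0)=0$ such that $\mathbb{P}\left(\forall s,t\in\mathbb{R}: |t-s|\le 1\implies |H(t)-H(s)|\le w(|t-s|)\right)=1$; (B) $\underline{H}>\frac1\alpha$; and that $w(h)\log(h)\to0$ as $h\downarrow0$. Let $X$ be the continuous modification of $$X(t)=\int_{\mathbb{R}}\left((t-x)_+^{H(x)-\frac1\alpha}-(-x)_+^{H(x)-\frac1\alpha}\right)dL(x),\qquad t\in\mathbb{R}.$$ Then, for all $t_0\in\mathbb{R}$, $$\mathbb{P}\left(\rho_X(t_0)\le H(t_0)\right)=1.$$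
   Context: Lévy process: $(\Omega,\mathcal{F},\mathbb{P})$ is a probability space, and $L$ is a two-sided càdlàg process with stationary independent increments, standardized so that $\mathbb{E}[e^{i(L(x)-L(y))u}]=e^{-|x-y|\,|u|^\alpha}$ for all $x,y,u\in\mathbb{R}$. $(\mathcal{F}_x)_{x\in\mathbb{R}}$ is the natural filtration of $L$, i.e. $\mathcal{F}_x$ is generated by the increments of $L$ up to $x$, so that increments of $L$ after $x$ are independent of $\mathcal{F}_x$. Notation: $(x)_+=\max(x,0)$, and $(x)_+^{c}$ means $x^c$ if $x>0$ and $0$ if $x\le0$. Stochastic integral: For an interval $I\subseteq\mathbb{R}$, $\mathbb{M}^\alpha(I)$ is the space of jointly measurable adapted processes $F:\Omega\times I\to\mathbb{R}$ with $\|F\|_{\mathbb{M}^\alpha(I)}=(\mathbb{E}\int_I|F(x)|^\alpha dx)^{1/\alpha}<\infty$. The weak Lebesgue space $\Lambda^\alpha(\Omega)$ consists of random variables $Z$ with $\|Z\|_{\Lambda^\alpha(\Omega)}=(\sup_{\lambda>0}\lambda^\alpha\mathbb{P}(|Z|>\lambda))^{1/\alpha}<\infty$. For a bounded interval $(a,b]$ and a simple process $F=\sum_{k=1}^n\xi_k\mathbf{1}_{(x_{k-1},x_k]}\in\mathbb{M}^\alpha((a,b])$ with $a=x_0<\dots<x_n=b$ and $\xi_k$ being $\mathcal{F}_{x_{k-1}}$-measurable, $\int_a^bF\,dL=\sum_k\xi_k(L(x_k)-L(x_{k-1}))$. There is a constant $C(\alpha)$, independent of $(a,b]$ and $F$,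 with $\|\int_a^bF\,dL\|_{\Lambda^\alpha(\Omega)}\le C(\alpha)\|F\|_{\mathbb{M}^\alpha((a,b])}$ (Giné–Marcus). By density of simple processes the integral extends to a bounded linear operator $\mathbb{M}^\alpha((a,b])\to\Lambda^\alpha(\Omega)$, and $\int_{\mathbb{R}}F\,dL$ for $F\in\mathbb{M}^\alpha(\mathbb{R})$ is the limit in $\Lambda^\alpha(\Omega)$ of $\int_a^bF\,dL$ as $(a,b]\uparrow\mathbb{R}$. The kernel defining $X(t)$ belongs to $\mathbb{M}^\alpha(\mathbb{R})$ for each $t$. Under (A) and (B), $X$ admits a modification with continuous sample paths (unique up to indistinguishability); $X$ is identified with it. Pointwise Hölder exponent of a continuous function $f:\mathbb{R}\to\mathbb{R}$ at $t$: $$\rho_f(t)=\sup\Big\{\rho\ge0:\limsup_{h\to0}\frac{|f(t+h)-f(t)|}{|h|^\rho}=0\Big\}.$$ For random $f$ it is defined pathwise. *)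

(* Defs.v *)
From HB Require Import structures.
From mathcomp Require Import all_boot all_order all_algebra.
From mathcomp Require Import all_classical all_reals all_analysis.
From mathcomp Require Import complex.

Set Implicit Arguments.
Unset Strict Implicit.
Unset Printing Implicit Defensive.

Import Order.TTheory GRing.Theory Num.Theory.
Import numFieldNormedType.Exports.

Local Open Scope classical_set_scope.
Local Open Scope ring_scope.

(* The test is needed because [powR x c] is 1, not 0, when [x < 0]. *)
Definition pos_powR (R : realType) (x c : R) : R :=
  if 0 < x then x `^ c else 0.

(* The supremum lives in the extended reals: it is +oo when, for instance, f
   is constant near t. [lime_sup] is taken over a punctured neighborhood. *)
Definition holder_exponent (R : realType) (f : R -> R) (t : R) : \bar R :=
  ereal_sup [set rho%:E | rho in [set rho : R | 0 <= rho /\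
    lime_sup (fun h => (`|f (t + h) - f t| / `|h| `^ rho)%:E) 0 = 0%E]].

Section processes.
Context {R : realType} {d : measure_display} {Omega : measurableType d}.
Implicit Types (P : probability Omega R) (L F : R -> Omega -> R).
Implicit Types (FF : R -> set_system Omega) (Z : Omega -> R).

Definition increment L (x y : R) : Omega -> R := fun w => L y w - L x w.

Definition cadlag (f : R -> R) : Prop :=
  forall x, f y @[y --> x^'+] --> f x /\ cvg (f y @[y --> x^'-]).

(* Taking some of the [B i] equal to [setT] gives the product rule for every
   subfamily. *)
Definition mutually_independent P n (Y : 'I_n -> Omega -> R) : Prop :=
  forall B : 'I_n -> set R, (forall i, measurable (B i)) ->
    P (\bigcap_i (Y i @^-1` B i)) = (\prod_(i < n) P (Y i @^-1` B i))%E.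

Definition independent_increments P L : Prop :=
  forall (n : nat) (x : nat -> R),
    {homo x : i j / (i <= j)%N >-> i <= j} ->
    mutually_independent P (fun k : 'I_n => increment L (x k) (x k.+1)).

(* Equality of laws is only required on Borel sets, as a measure is arbitrary
   on non-measurable sets. *)
Definition stationary_increments P L : Prop :=
  forall (x y h : R) (B : set R), measurable B ->
    P (increment L (x + h) (y + h) @^-1` B) = P (increment L x y @^-1` B).

(* [E[exp(i u Z)]], integrated componentwise. *)
Definition char_fun P Z (u : R) : R[i] :=
  Complex (fine 'E_P[fun w => cos (u * Z w)])
          (fine 'E_P[fun w => sin (u * Z w)]).

Record symmetric_stable_levy P (alpha : R) L : Prop := {
  levy_measurable : forall x, measurable_fun setT (L x) ;
  levy_cadlag : forall w, cadlag (fun x => L x w) ;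
  levy_independent : independent_increments P L ;
  levy_stationary : stationary_increments P L ;
  levy_char_fun : forall x y u : R,
    char_fun P (increment L y x) u =
    (expR (- (`|x - y| * `|u| `^ alpha)))%:C%C }.

Definition natural_filtration L (x : R) : set_system Omega :=
  <<s [set A | exists y z, [/\ y <= x, z <= x &
         preimage_set_system setT (increment L y z) measurable A]] >>.

Definition meas_wrt (G : set_system Omega) Z : Prop :=
  preimage_set_system setT Z measurable `<=` G.

Definition adapted FF (I : set R) F : Prop :=
  forall x, I x -> meas_wrt (FF x) (F x).

Definition jointly_measurable (I : set R) F : Prop :=
  measurable_fun (setT `*` I) (fun p : Omega * R => F p.2 p.1).

Definition normM P (alpha : R) (I : set R) F : \bar R :=
  ((\int[P]_w \int[lebesgue_measure]_(x in I) (`|F x w| `^ alpha)%R%:E)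
     `^ alpha^-1)%E.

Definition spaceM P (alpha : R) FF (I : set R) F : Prop :=
  [/\ jointly_measurable I F, adapted FF I F &
      (normM P alpha I F < +oo)%E].

Definition weak_norm P (alpha : R) Z : \bar R :=
  (ereal_sup [set (lambda `^ alpha)%R%:E * P [set w | (lambda < `|Z w|)%R]
             | lambda in [set lambda : R | (0 < lambda)%R]] `^ alpha^-1)%E.

Definition weak_space P (alpha : R) Z : Prop :=
  measurable_fun setT Z /\ (weak_norm P alpha Z < +oo)%E.

(* [sp_coef k] is the coefficient on the interval
   ]sp_point k, sp_point k.+1], for k < sp_size. *)
Record simple_process FF (a b : R) := SimpleProcess {
  sp_size : nat ;
  sp_point : nat -> R ;
  sp_coef : nat -> Omega -> R ;
  sp_first : sp_point 0 = a ;
  sp_last : sp_point sp_size = b ;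
  sp_lt : forall k, (k < sp_size)%N -> sp_point k < sp_point k.+1 ;
  sp_meas : forall k, (k < sp_size)%N ->
    meas_wrt (FF (sp_point k)) (sp_coef k) }.

Definition sp_fun FF a b (S : simple_process FF a b) : R -> Omega -> R :=
  fun x w => \sum_(k < sp_size S)
    sp_coef S k w * \1_(`]sp_point S k, sp_point S k.+1]) x.

Definition sp_integral L FF a b (S : simple_process FF a b) : Omega -> R :=
  fun w => \sum_(k < sp_size S)
    sp_coef S k w * increment L (sp_point S k) (sp_point S k.+1) w.

(* Z is a version of the integral of F over ]a, b] against L: the pair (F, Z)
   is in the closure, in M^alpha x Lambda^alpha, of the graph of the integral
   on simple processes. By the Gine-Marcus bound this closure is the graph of
   the continuous extension, so Z is determined by F almost surely. *)
Definition is_integral_itv P (alpha : R) L FF (a b : R) F Z : Prop :=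
  [/\ spaceM P alpha FF `]a, b] F, weak_space P alpha Z &
    exists S : nat -> simple_process FF a b,
    [/\ forall n, spaceM P alpha FF `]a, b] (sp_fun (S n)),
        normM P alpha `]a, b] (fun x w => sp_fun (S n) x w - F x w)
          @[n --> \oo] --> 0%E &
        weak_norm P alpha (fun w => sp_integral L (S n) w - Z w)
          @[n --> \oo] --> 0%E]].

Definition is_integral P (alpha : R) L FF F Z : Prop :=
  [/\ spaceM P alpha FF setT F, weak_space P alpha Z &
    exists J : R -> R -> Omega -> R,
      (forall a b, a < b -> is_integral_itv P alpha L FF a b F (J a b)) /\
      weak_norm P alpha (fun w => J p.1 p.2 w - Z w)
        @[p --> filter_prod (ninfty_nbhs R) (pinfty_nbhs R)] --> 0%E].

Definition multifractional_kernel (alpha : R) (H : R -> Omega -> R) (t : R) : R -> Omega -> R :=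
  fun x w => pos_powR (t - x) (H x w - alpha^-1)
             - pos_powR (- x) (H x w - alpha^-1).

End processes.

(* Main.v *)
Require Import Defs.
From HB Require Import structures.
From mathcomp Require Import all_boot all_order all_algebra.
From mathcomp Require Import all_classical all_reals all_analysis.
From mathcomp Require Import measurable_realfun.
From mathcomp Require Import ring lra zify.

(** Fix [t0] and put [D h = h `^ (- H t0) * (X (t0 + h) - X t0)]. If the Holder
    exponent at [t0] exceeds [H t0], then [D h] tends to 0 with [h]; the theorem
    holds because, with probability one, [D h] does not tend to 0 along [h = 1 / n].

    The reason is that the laws of [D h] cannot concentrate near 0. Split the
    integral that defines the increment over [h > 0] at [t0]. The part before [t0]
    is known at [t0]. The part after [t0] is the integral against [L] over
    ]t0, t0 + h] of the function [(t0 + h - x) `^ (H x - alpha^-1)]; up to a small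
    error the exponent can be frozen at its value at [t0], and then, given the past
    of [t0], this part is symmetric stable and the power [alpha] of its scale is
    [h `^ (alpha * H t0) / (alpha * H t0)]. Adding a variable known at [t0] does not
    increase the modulus of a conditional characteristic function. Hence the
    characteristic function of [D h] at [u] is at most [expR (- `|u| `^ alpha / alpha)]
    up to a term that vanishes with [h] ([cos_limit]). Such a decay at high
    frequencies bounds the mass of small balls uniformly in [h] ([small_ball]) and
    makes convergence to 0 a negligible event ([negligible_cvg0]).

    The conditional statement is made on simple processes, where no theory of the
    stochastic integral is needed ([chain_cos_bound]): multiply the cosine of the
    integral up to a given time by the exponential of the energy
    [\sum_k (r k.+1 - r k) * `|xi k| `^ alpha] spent so far minus the energy [G]
    expected in total. This compensates the decay of the characteristic function
    and gives a martingale; stopping the compensation once [G] is spent, the error is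
    at most the mean of the distance between the total energy and [G]. For
    approximations of the kernel this distance is controlled by
    [energy_comparison]: scaling shows that freezing the exponent costs a factor
    governed by [w h * ln h], which tends to 0. The definition of the integral
    provides simple processes whose energy error is arbitrarily small and whose
    integrals are close to [X t0] and [X (t0 + h)] in probability
    ([integral_approx]), and the cosine turns closeness in probability into
    closeness of means. *)

Set Implicit Arguments.
Unset Strict Implicit.
Unset Printing Implicit Defensive.

Import Order.TTheory GRing.Theory Num.Theory.
Import numFieldNormedType.Exports.

Local Open Scope classical_set_scope.
Local Open Scope ring_scope.

(** * Independence of the increments from the past *)

Lemma integrable_bounded (R : realType) d (T : measurableType d)
    (Q : probability T R) (g : T -> R) (M : R) :
  measurable_fun setT g -> (forall z, `|g z| <= M) ->
  Q.-integrable setT (EFin \o g).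
Proof.
move=> mg gM; apply: measurable_bounded_integrable => //.
  by rewrite (le_lt_trans (probability_le1 _ _)) ?ltry.
by exists M; split; [exact: num_real|move=> K MK z _; exact: le_trans (ltW MK)].
Qed.

Lemma abs_Rintegral_le (R : realType) d (T : measurableType d)
    (Q : probability T R) (g h : T -> R) (M : R) :
  measurable_fun setT g -> (forall z, `|g z| <= M) ->
  measurable_fun setT h -> (forall z, `|g z| <= h z) ->
  (`|\int[Q]_z g z|%:E <= \int[Q]_z (h z)%:E)%E.
Proof.
move=> mg gM mh gh; have ig := integrable_bounded Q mg gM.
rewrite EFin_normr_Rintegral//; apply: (le_trans (le_abse_integral _ _ _)) => //.
  exact/measurable_EFinP.
apply: ge0_le_integral => //=.
- by do 2 apply: measurableT_comp => //.
- exact/measurable_EFinP.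
- by move=> z _; rewrite lee_fin.
Qed.

Section independence.
Context {R : realType} {d : measure_display} {Omega : measurableType d}.
Variable P : probability Omega R.
Implicit Types (G : set_system Omega) (Y : Omega -> R) (L : R -> Omega -> R).

(** Adaptedness is measurability on the same carrier equipped with a smaller
    sigma-algebra, so the closure properties of measurable functions apply. *)
Lemma meas_wrtP G (Z : Omega -> R) :
  meas_wrt <<s G >> Z <->
  measurable_fun (setT : set (g_sigma_algebraType G)) Z.
Proof.
split=> [GZ _ B mB|mZ A [B mB <-]]; last exact: mZ.
by apply: GZ; exists B.
Qed.

Lemma sub_meas_wrt G G' (Z : Omega -> R) :
  G `<=` G' -> meas_wrt G Z -> meas_wrt G' Z.
Proof. by move=> GG' GZ A ZA; apply/GG'/GZ. Qed.

Lemma meas_wrt_measurable G (Z : Omega -> R) :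
  G `<=` measurable -> meas_wrt G Z -> measurable_fun setT Z.
Proof. by move=> Gm GZ _ B mB; apply/Gm/GZ; exists B. Qed.

Definition indep_of G Y := forall A B, G A -> measurable B ->
  P (A `&` Y @^-1` B) = (P A * P (Y @^-1` B))%E.

(** Both sides of the product rule are finite measures in the first set, so they
    agree on a sigma-algebra once they agree on a generating pi-system. *)
Lemma indep_of_sigma G Y : measurable_fun setT Y -> setI_closed G -> G setT ->
  G `<=` measurable -> indep_of G Y -> indep_of <<s G >> Y.
Proof.
move=> mY GI GT Gm GY A B GA mB.
have mYB : measurable (Y @^-1` B) by rewrite -[X in measurable X]setTI; exact: mY.
pose m1 := mrestr P mYB.
have p0 : (0 <= fine (P (Y @^-1` B)))%R by rewrite fine_ge0.
pose m2 := mscale (NngNum p0) P.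
have m1E C : m1 C = P (C `&` Y @^-1` B) by [].
have m2E C : m2 C = (P C * P (Y @^-1` B))%E.
  by rewrite /m2 /mscale /= fineK ?fin_num_measure// muleC.
rewrite -m1E -m2E.
apply: (@g_sigma_algebra_measure_unique _ R Omega G Gm (fun _ => setT)) => //.
- by rewrite -subTset => w _; exists 0%N.
- by move=> C GC; have := GY C B GC mB; rewrite -m1E -m2E.
- by move=> _; rewrite /= /mrestr setTI (le_lt_trans (probability_le1 _ _)) ?ltry.
Qed.

Lemma indep_of_sub G G' Y : G `<=` G' -> indep_of G' Y -> indep_of G Y.
Proof. by move=> GG' iY A B /GG'; exact: iY. Qed.

Lemma increment_measurable L : (forall x, measurable_fun setT (L x)) ->
  forall x y, measurable_fun setT (increment L x y).
Proof. by move=> mL x y; apply: measurable_funB. Qed.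

(** With [T] the half-line below [x], this is the generating family of
    [natural_filtration L x]. *)
Definition increments_of L (T : set R) : set_system Omega :=
  [set A | exists y z, [/\ T y, T z &
     preimage_set_system setT (increment L y z) measurable A]].

(** Intersections of events on consecutive increments form a pi-system, whereas
    single events on arbitrary increments do not. *)
Definition chain_rectangles L (x : nat -> R) n : set_system Omega :=
  [set A | exists2 B : 'I_n -> set R, (forall i, measurable (B i)) &
     A = \bigcap_(i in [set: 'I_n]) (increment L (x i) (x i.+1) @^-1` B i)].

Section levy.
Variable L : R -> Omega -> R.
Hypothesis mL : forall x, measurable_fun setT (L x).
Hypothesis iL : independent_increments P L.

Lemma increments_of_measurable T : increments_of L T `<=` measurable.
Proof.
by move=> A [y [z [_ _ [B mB <-]]]]; apply: increment_measurable.
Qed.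

Lemma chain_indep (x : nat -> R) n :
  {homo x : i j / (i <= j)%N >-> i <= j} ->
  indep_of <<s chain_rectangles L x n >> (increment L (x n) (x n.+1)).
Proof.
move=> hx; have mI := increment_measurable mL.
have mIB a b B : measurable B -> measurable (increment L a b @^-1` B).
  by move=> mB; rewrite -[X in measurable X]setTI; exact: mI.
apply: indep_of_sigma => //.
- move=> _ _ [B mB ->] [C mC ->]; exists (fun i => B i `&` C i).
    by move=> i; exact: measurableI.
  apply/seteqP; split=> [w [Bw Cw] i _|w BC]; first by split; [exact: Bw|exact: Cw].
  by split=> i _; have [] := BC i I.
- by exists (fun=> setT) => //; apply/seteqP; split.
- move=> _ [B mB ->]; apply: fin_bigcap_measurable => // i _; exact: mIB.
move=> _ B [C mC ->] mB.
(* Append [B] to the rectangle as the event on the last increment. *)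
pose D (i : 'I_n.+1) := if unlift ord_max i is Some j then C j else B.
have mD i : measurable (D i) by rewrite /D; case: unlift => [j|].
have Dw (i : 'I_n) : D (widen_ord (leqnSn n) i) = C i.
  have -> : widen_ord (leqnSn n) i = lift ord_max i.
    by apply/val_inj; rewrite /= /bump leqNgt ltn_ord.
  by rewrite /D liftK.
have Dm : D ord_max = B by rewrite /D unlift_none.
have -> : \bigcap_(i in [set: 'I_n]) (increment L (x i) (x i.+1) @^-1` C i)
    `&` increment L (x n) (x n.+1) @^-1` B =
    \bigcap_(i in [set: 'I_n.+1]) (increment L (x i) (x i.+1) @^-1` D i).
  apply/seteqP; split=> [w [Cw Bw] i _|w Dww].
    have [j ->|->] := unliftP ord_max i; last by rewrite Dm.
    rewrite /D liftK /= /bump leqNgt ltn_ord add0n; exact: Cw.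
  split=> [i _|]; last by have := Dww ord_max I; rewrite Dm.
  by have := Dww (widen_ord (leqnSn n) i) I; rewrite Dw.
rewrite (iL hx mD) big_ord_recr/= Dm; congr (_ * _)%E.
rewrite (iL hx mC); apply: eq_bigr => i _; by rewrite Dw.
Qed.

(** An increment between two points of a chain is a sum of consecutive ones. *)
Lemma chain_increments (x : nat -> R) n (s : set R) :
  (forall y, s y -> exists2 i, (i <= n)%N & x i = y) ->
  increments_of L s `<=` <<s chain_rectangles L x n >>.
Proof.
move=> sx; pose T := g_sigma_algebraType (chain_rectangles L x n).
have mI i : (i < n)%N ->
    measurable_fun (setT : set T) (increment L (x i) (x i.+1) : T -> R).
  move=> ni _ B mB; rewrite setTI; apply: sub_sigma_algebra.
  exists (fun j : 'I_n => if j == Ordinal ni then B else setT).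
    by move=> j; case: ifP.
  apply/seteqP; split=> [w Bw j _|w /(_ (Ordinal ni) I)]; last by rewrite eqxx.
  by case: ifPn => // /eqP ->.
have mx i : (i <= n)%N ->
    measurable_fun (setT : set T) (increment L (x 0%N) (x i) : T -> R).
  elim: i => [_|i IH ni].
    have -> : increment L (x 0%N) (x 0%N) = cst 0.
      by apply/funext => w; rewrite /increment subrr.
    exact: measurable_cst.
  have -> : increment L (x 0%N) (x i.+1) =
      (increment L (x 0%N) (x i) \+ increment L (x i) (x i.+1)).
    by apply/funext => w; rewrite /increment /=; ring.
  by apply: measurable_funD; [apply: IH; exact: ltnW|exact: mI].
move=> _ [y [z [/sx [i ni <-] /sx[j nj <-] [B mB <-]]]].
have mij : measurable_fun (setT : set T) (increment L (x i) (x j) : T -> R).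
  have -> : increment L (x i) (x j) =
      (increment L (x 0%N) (x j) \- increment L (x 0%N) (x i)).
    by apply/funext => w; rewrite /increment /=; ring.
  by apply: measurable_funB; exact: mx.
exact: mij.
Qed.

Lemma finite_past_indep (s : seq R) x y : {in s, forall z, z <= x} -> x <= y ->
  indep_of <<s increments_of L [set` s] >> (increment L x y).
Proof.
move=> sx xy; pose r := rcons (sort <=%R s) x.
have szr : size r = (size s).+1 by rewrite size_rcons size_sort.
have rx z : z \in r -> z <= x.
  by rewrite mem_rcons inE mem_sort => /orP[/eqP -> //|]; exact: sx.
have sr : sorted <=%R r.
  rewrite /r le_sorted_pairwise pairwise_rcons -le_sorted_pairwise.
  rewrite sort_le_sorted andbT.
  by apply/allP => z; rewrite mem_sort; exact: sx.
have homr : {homo nth y r : i j / (i <= j)%N >-> i <= j}.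
  move=> i j ij; have [rj|rj] := leqP (size r) j.
    rewrite (nth_default _ rj); have [ri|ri] := leqP (size r) i.
      by rewrite nth_default.
    by apply: le_trans xy; apply: rx; exact: mem_nth.
  by apply: le_sorted_leq_nth => //; rewrite inE// (leq_ltn_trans ij).
have := @chain_indep (nth y r) (size s) homr.
have -> : nth y r (size s) = x by rewrite /r nth_rcons size_sort ltnn eqxx.
rewrite (nth_default _ (_ : size r <= (size s).+1)%N) ?szr//.
apply: indep_of_sub; apply: smallest_sub; first exact: smallest_sigma_algebra.
apply: chain_increments => z /= zs; exists (index z (sort <=%R s)).
  by rewrite -(size_sort <=%R) index_size.
have zi : (index z (sort <=%R s) < size (sort <=%R s))%N.
  by rewrite index_mem mem_sort.
by rewrite /r nth_rcons zi nth_index// mem_sort.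
Qed.

(** Events that depend on finitely many times form a pi-system, by merging the
    sets of times, and they generate the past. *)
Lemma natural_filtration_indep x y : x <= y ->
  indep_of (natural_filtration L x) (increment L x y).
Proof.
move=> xy; pose G := [set A | exists2 s : seq R, {in s, forall z, z <= x} &
  <<s increments_of L [set` s] >> A].
have inc (s t : seq R) : {subset s <= t} ->
    <<s increments_of L [set` s] >> `<=` <<s increments_of L [set` t] >>.
  move=> st; apply: sub_sigma_algebra2 => A [u [v [us vs Huv]]].
  by exists u, v; split=> //; exact: st.
have : indep_of <<s G >> (increment L x y).
  apply: indep_of_sigma.
  - exact: increment_measurable.
  - move=> A B [s sx sA] [t tx tB]; exists (s ++ t).
      by move=> z; rewrite mem_cat => /orP[]; [exact: sx|exact: tx].
    apply: (@measurableI _ (g_sigma_algebraType (increments_of L [set` s ++ t]))).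
      by apply: inc sA => z zs; rewrite mem_cat zs.
    by apply: inc tB => z zs; rewrite mem_cat zs orbT.
  - by exists [::] => //; exact: (@measurableT _ (g_sigma_algebraType _)).
  - move=> A [s _]; apply: smallest_sub; first exact: sigma_algebra_measurable.
    exact: increments_of_measurable.
  - by move=> A B [s sx sA] mB; exact: (finite_past_indep sx xy sA mB).
apply: indep_of_sub; apply: sub_sigma_algebra2 => A [u [v [ux vx uvA]]].
exists [:: u; v]; first by move=> z; rewrite !inE => /orP[]/eqP ->.
apply: sub_sigma_algebra; exists u, v; split=> //=.
  by rewrite inE eqxx.
by rewrite !inE eqxx orbT.
Qed.

Lemma natural_filtration_measurable x : natural_filtration L x `<=` measurable.
Proof.
apply: smallest_sub; first exact: sigma_algebra_measurable.
exact: (@increments_of_measurable [set y | y <= x]).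
Qed.

Lemma natural_filtration_mono x y : x <= y ->
  natural_filtration L x `<=` natural_filtration L y.
Proof.
move=> xy; apply: sub_sigma_algebra2 => A [u [v [ux vx uvA]]].
by exists u, v; split=> //; exact: le_trans xy.
Qed.

Lemma increment_meas_wrt x y z : y <= x -> z <= x ->
  meas_wrt (natural_filtration L x) (increment L y z).
Proof. by move=> yx zx A yzA; apply: sub_sigma_algebra; exists y, z. Qed.

End levy.

(** Integrating out an independent variable: Fubini for the joint law of the
    identity, seen as a variable with values in the smaller measurable space,
    and of [Y], which is a product measure. *)
Lemma integral_indep G Y (f : g_sigma_algebraType G * R -> R) :
  G `<=` measurable -> measurable_fun setT Y -> indep_of <<s G >> Y ->
  measurable_fun setT f -> (exists M : R, forall z, `|f z| <= M) ->
  \int[P]_w f (w, Y w) = \int[P]_w \int[P]_w' f (w, Y w').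
Proof.
move=> Gm mY iY mf [M fM].
pose T : measurableType _ := g_sigma_algebraType G.
have mid : measurable_fun (setT : set Omega) (id : Omega -> T).
  by move=> _ A GA; rewrite setTI; apply: (smallest_sub _ Gm GA);
    exact: sigma_algebra_measurable.
have mphi : measurable_fun (setT : set Omega) (fun w => (w : T, Y w)).
  exact: measurable_fun_pair.
pose X1 : {mfun Omega >-> T} := mfun_Sub (mem_set mid).
pose X2 : {mfun Omega >-> R} := mfun_Sub (mem_set mY).
pose X3 : {mfun Omega >-> (T * R)%type} := mfun_Sub (mem_set mphi).
have mEf : measurable_fun setT (EFin \o f) by exact/measurable_EFinP.
have bint d' (T' : measurableType d') (Q : probability T' R) (g : T' -> R) :=
  @integrable_bounded R d' T' Q g M.
have prodE A : measurable A ->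
    (distribution P X1 \x distribution P X2)%E A = distribution P X3 A.
  apply: product_measure_unique => B C mB mC.
  exact: iY.
rewrite {1}/Rintegral -(integral_distribution (X := X3) mEf); last first.
  by apply: (bint _ _ _ (fun w => f (w, Y w))) => //; exact: (measurableT_comp mf mphi).
rewrite -(eq_measure_integral _ (fun A mA _ => prodE A mA)).
rewrite -integral12_prod_meas1; last exact: bint.
have FE w : fubini_F (distribution P X2) (EFin \o f) w =
    (\int[P]_w' f (w, Y w'))%:E.
  have mfw : measurable_fun setT (fun y => f (w, y)).
    by apply: (measurableT_comp mf); exact: measurable_fun_pair.
  rewrite /fubini_F integral_distribution; last 2 first.
  - exact/measurable_EFinP.
  - by apply: (bint _ _ _ (fun w' => f (w, Y w'))) => //; exact: (measurableT_comp mfw mY).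
  rewrite /Rintegral fineK// integrable_fin_num//.
  by apply: (bint _ _ _ (fun w' => f (w, Y w'))) => //; exact: (measurableT_comp mfw mY).
have mF : measurable_fun setT (fubini_F (distribution P X2) (EFin \o f)).
  exact: (measurable_fubini_F (m1 := distribution P X1) (bint _ _ _ _ mf fM)).
rewrite integral_distribution.
- by congr fine; apply: eq_integral => w _ /=; rewrite FE.
- exact: mF.
rewrite (_ : _ \o _ =
    EFin \o (fun w : Omega => \int[P]_w' f (w, Y w'))); last first.
  by apply/funext => w /=; rewrite FE.
apply: (bint _ _ _ (fun w : Omega => \int[P]_w' f (w, Y w'))).
  apply/measurable_EFinP.
  rewrite (_ : _ \o _ = fubini_F (distribution P X2) (EFin \o f) \o X1).
    exact: measurableT_comp.
  by apply/funext => w /=; rewrite FE.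
move=> w; have mfw : measurable_fun setT (fun w' => f (w, Y w')).
  have mfw : measurable_fun setT (fun y => f (w, y)).
    by apply: (measurableT_comp mf); exact: measurable_fun_pair.
  exact: (measurableT_comp mfw mY).
apply: (le_trans (le_normr_Rintegral _ (bint _ _ _ _ mfw _))) => //.
apply: (@le_trans _ _ (\int[P]_w' M)).
  apply: le_Rintegral => //.
    apply: (bint _ _ _ (fun w' => `|f (w, Y w')|)) => [|w'].
      exact: measurableT_comp.
    by rewrite normr_id.
  apply: (bint _ _ P (fun _ : Omega => M)); first exact: measurable_cst.
  by move=> w'; rewrite ger0_norm// (le_trans _ (fM (w, 0))).
by rewrite Rintegral_cst//= [P _]probability_setT mulr1.
Qed.

End independence.

(** * Characteristic functions of stochastic sums *)

Section martingale_bound.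
Context {R : realType} {d : measure_display} {Omega : measurableType d}.
Variables (P : probability Omega R) (alpha : R) (L : R -> Omega -> R).
Hypothesis L_levy : symmetric_stable_levy P alpha L.

Let mL := levy_measurable L_levy.
Let iL := levy_independent L_levy.
Let mF := natural_filtration_measurable mL.

Lemma stable_cos x y u : \int[P]_w cos (u * increment L x y w) =
  expR (- (`|y - x| * `|u| `^ alpha)).
Proof.
have := levy_char_fun L_levy y x u.
by rewrite /char_fun unlock /Rintegral; case.
Qed.

Lemma stable_sin x y u : \int[P]_w sin (u * increment L x y w) = 0.
Proof.
have := levy_char_fun L_levy y x u.
by rewrite /char_fun unlock /Rintegral; case.
Qed.

Lemma measurable_cos_comp d' (T : measurableType d') (f : T -> R) :
  measurable_fun setT f -> measurable_fun setT (fun z => cos (f z)).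
Proof.
move=> mf; apply: measurableT_comp mf.
by apply: continuous_measurable_fun; exact: continuous_cos.
Qed.

Lemma measurable_sin_comp d' (T : measurableType d') (f : T -> R) :
  measurable_fun setT f -> measurable_fun setT (fun z => sin (f z)).
Proof.
move=> mf; apply: measurableT_comp mf.
by apply: continuous_measurable_fun; exact: continuous_sin.
Qed.

Lemma normr_cos_le1 (x : R) : `|cos x| <= 1.
Proof. by rewrite ler_norml cos_geN1 cos_le1. Qed.

Lemma normr_sin_le1 (x : R) : `|sin x| <= 1.
Proof. by rewrite ler_norml sin_geN1 sin_le1. Qed.

Lemma stable_cos_shift x y z c : \int[P]_w cos (z + c * increment L x y w) =
  cos z * expR (- (`|y - x| * `|c| `^ alpha)).
Proof.
have mI : measurable_fun setT (fun w => c * increment L x y w).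
  by apply: measurable_funM => //; exact: increment_measurable.
have icos : P.-integrable setT (EFin \o (fun w => cos (c * increment L x y w))).
  apply: (integrable_bounded P (M := 1)) => [|?]; last exact: normr_cos_le1.
  exact: measurable_cos_comp.
have isin : P.-integrable setT (EFin \o (fun w => sin (c * increment L x y w))).
  apply: (integrable_bounded P (M := 1)) => [|?]; last exact: normr_sin_le1.
  exact: measurable_sin_comp.
under eq_Rintegral do rewrite cosD.
rewrite RintegralB//; last 2 first.
- exact: (integrableZl measurableT (cos z) icos).
- exact: (integrableZl measurableT (sin z) isin).
rewrite RintegralZl// RintegralZl// stable_cos stable_sin mulr0 subr0.
by [].
Qed.

(** Conditionally on the past, [increment L x y] keeps its symmetric stable law:
    the sine part integrates to zero and the cosine part produces the factor
    [expR (- ..)]. *)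
Lemma cos_indep_increment x y (Z xi B : Omega -> R) (M : R) : x <= y ->
  meas_wrt (natural_filtration L x) Z ->
  meas_wrt (natural_filtration L x) xi ->
  meas_wrt (natural_filtration L x) B -> (forall w, `|B w| <= M) ->
  \int[P]_w (cos (Z w + xi w * increment L x y w) * B w) =
  \int[P]_w (cos (Z w) * (expR (- (`|y - x| * `|xi w| `^ alpha)) * B w)).
Proof.
move=> xy /meas_wrtP mZ /meas_wrtP mxi /meas_wrtP mB BM.
set G := [set A | _] in mZ mxi mB.
pose T : measurableType _ := g_sigma_algebraType G.
have mI := increment_measurable mL x y.
have Gm : G `<=` measurable by exact: (@increments_of_measurable _ _ _ _ mL [set y | y <= x]).
have mf (h : Omega -> R) : measurable_fun (setT : set T) h ->
    measurable_fun (setT : set (T * R)%type) (fun z => h z.1).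
  by move=> mh; apply: measurableT_comp.
rewrite (@integral_indep _ _ _ P G (increment L x y)
  (fun z => cos (Z z.1 + xi z.1 * z.2) * B z.1)) => //.
- apply: eq_Rintegral => w _ /=.
  rewrite RintegralZr//.
    by rewrite stable_cos_shift mulrA.
  apply: (integrable_bounded P (M := 1)) => [|?]; last exact: normr_cos_le1.
  apply/measurable_cos_comp/measurable_funD => //.
  exact: measurable_funM.
- exact: natural_filtration_indep.
- apply: measurable_funM; last exact: mf.
  apply: measurable_cos_comp; apply: measurable_funD; first exact: mf.
  by apply: measurable_funM => //; exact: mf.
- exists M => z; rewrite normrM (le_trans _ (BM z.1))// ler_piMl//.
  exact: normr_cos_le1.
Qed.

Section chain.
Variables (r : nat -> R) (xi : nat -> Omega -> R) (Y G : Omega -> R).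
Hypothesis r_homo : {homo r : i j / (i <= j)%N >-> i <= j}.
Hypothesis xi_meas : forall k, meas_wrt (natural_filtration L (r k)) (xi k).
Hypothesis Y_meas : meas_wrt (natural_filtration L (r 0%N)) Y.
Hypothesis G_meas : meas_wrt (natural_filtration L (r 0%N)) G.
Hypothesis G_ge0 : forall w, 0 <= G w.

(** [A n] is the intrinsic clock of the stochastic integral [Z n]: conditionally
    on the past, adding the term of rank [n] to [Z n] multiplies the characteristic
    function by [expR (A n - A n.+1)]. *)
Let Z n w := Y w + \sum_(k < n) xi k w * increment L (r k) (r k.+1) w.
Let A n w := \sum_(k < n) (r k.+1 - r k) * `|xi k w| `^ alpha.
Let pos n w := Num.max (A n w - G w) 0.
Let neg n w := Num.min (A n w - G w) 0.

(** The carrier of [Omega] with the past of [r n] as its sigma-algebra. *)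
Let T n : measurableType _ :=
  g_sigma_algebraType (increments_of L [set y | y <= r n]).

Let lift n (f : Omega -> R) k : (k <= n)%N ->
  meas_wrt (natural_filtration L (r k)) f ->
  measurable_fun (setT : set (T n)) f.
Proof.
move=> kn mf; apply/meas_wrtP; apply: sub_meas_wrt mf.
by apply: natural_filtration_mono; exact: r_homo.
Qed.

Let mZ n : measurable_fun (setT : set (T n)) (Z n).
Proof.
apply: measurable_funD; first exact: (lift (k := 0)).
apply: measurable_sum => k; apply: measurable_funM.
  by apply: (lift (k := k)) => //; exact: ltnW.
apply: (lift (k := k.+1)) => //.
by apply: increment_meas_wrt => //; exact: r_homo.
Qed.

Let mA n m : (m <= n.+1)%N -> measurable_fun (setT : set (T n)) (A m).
Proof.
move=> mn.
apply: measurable_sum => k; apply: measurable_funM => //.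
apply: (measurableT_comp (measurable_powR _)).
apply: measurableT_comp => //.
by apply: (lift (k := k)) => //; rewrite -ltnS (leq_trans _ mn).
Qed.

Let mG n : measurable_fun (setT : set (T n)) G.
Proof. exact: (lift (k := 0)). Qed.

Let toOmega n (f : Omega -> R) : measurable_fun (setT : set (T n)) f ->
  measurable_fun setT f.
Proof. by move=> /meas_wrtP; exact: meas_wrt_measurable (@mF (r n)). Qed.

Let mneg n m : (m <= n.+1)%N -> measurable_fun (setT : set (T n)) (neg m).
Proof.
move=> mn; apply: measurable_minr => //; apply: measurable_funB => //; exact: mA.
Qed.

Let mpos n : measurable_fun setT (pos n).
Proof.
apply: (@toOmega n); apply: measurable_maxr => //.
by apply: measurable_funB => //; exact: mA.
Qed.

Let expR_neg n w : 0 <= expR (neg n w) <= 1.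
Proof. by rewrite expR_ge0 expR_le1 /neg ge_min lexx orbT. Qed.

Let normr_cos_expR_neg n w : `|cos (Z n w) * expR (neg n w)| <= 1.
Proof.
have /andP[e0 e1] := expR_neg n w.
by rewrite normrM mulr_ile1// ?normr_cos_le1// ger0_norm.
Qed.

Let mcos n : measurable_fun setT (fun w => cos (Z n w)).
Proof. by apply: measurable_cos_comp; exact: toOmega. Qed.

Let mexpneg n : measurable_fun setT (fun w => expR (neg n w)).
Proof.
apply: measurableT_comp => //; apply: (@toOmega n); exact: mneg.
Qed.

(** [expR (neg n)] compensates the decay of the conditional characteristic
    function only as long as [A n <= G]; beyond, it is the overshoot [pos] that
    bounds the error. *)
Let compensation n w : `|expR (- ((r n.+1 - r n) * `|xi n w| `^ alpha)) *
    expR (neg n.+1 w) - expR (neg n w)| <= pos n.+1 w - pos n w.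
Proof.
set a := (r n.+1 - r n) * _.
have a0 : 0 <= a by rewrite mulr_ge0 ?powR_ge0// subr_ge0 r_homo.
have AS : A n.+1 w = A n w + a by rewrite /A big_ord_recr.
have minE x : Num.min x 0 = x - Num.max x 0 :> R.
  by case: (leP x 0) => _; rewrite ?subr0 ?subrr.
have pp : pos n w <= pos n.+1 w.
  rewrite /pos AS ge_max !le_max lexx orbT andbT; apply/orP; left; lra.
rewrite -expRD.
have -> : - a + neg n.+1 w = neg n w - (pos n.+1 w - pos n w).
  by rewrite /neg !minE /pos AS; lra.
have /andP[e0 e1] := expR_neg n w.
set x := pos n.+1 w - pos n w in pp *.
have x0 : 0 <= x by rewrite subr_ge0.
have ex := expR_ge1Dx (- x).
have ex1 : expR (- x) <= 1 by rewrite expR_le1; lra.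
rewrite expRD; set e := expR (neg n w) in e0 e1 *.
rewrite ler0_norm; last by nra.
by nra.
Qed.

(** As long as [A n <= G] the process [cos (Z n) * expR (neg n)] is a martingale;
    afterwards its drift is bounded by the growth of the overshoot. *)
Let step n :
  (`|\int[P]_w (cos (Z n.+1 w) * expR (neg n.+1 w)) -
     \int[P]_w (cos (Z n w) * expR (neg n w))|%:E
   <= \int[P]_w (pos n.+1 w - pos n w)%:E)%E.
Proof.
have -> : \int[P]_w (cos (Z n.+1 w) * expR (neg n.+1 w)) =
    \int[P]_w (cos (Z n w) *
      (expR (- ((r n.+1 - r n) * `|xi n w| `^ alpha)) * expR (neg n.+1 w))).
  rewrite -[r n.+1 - r n in RHS]ger0_norm ?subr_ge0 ?r_homo//.
  rewrite -(@cos_indep_increment (r n) (r n.+1) (Z n) (xi n) _ 1) ?r_homo//.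
  - by apply: eq_Rintegral => w _; rewrite /Z big_ord_recr/= addrA.
  - by apply/meas_wrtP; exact: mZ.
  - by apply/meas_wrtP; apply: measurableT_comp => //; exact: mneg.
  - by move=> w; have /andP[? ?] := expR_neg n.+1 w; rewrite ger0_norm.
set f := fun w => expR (- ((r n.+1 - r n) * `|xi n w| `^ alpha)) * expR (neg n.+1 w).
have f01 w : 0 <= f w <= 1.
  rewrite /f -expRD expR_ge0 expR_le1/=.
  have : 0 <= (r n.+1 - r n) * `|xi n w| `^ alpha.
    by rewrite mulr_ge0 ?powR_ge0// subr_ge0 r_homo.
  have : neg n.+1 w <= 0 by rewrite /neg ge_min lexx orbT.
  by lra.
have mf : measurable_fun setT f.
  apply: measurable_funM => //; apply: measurableT_comp => //.
  apply: measurable_funN; apply: measurable_funM => //.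
  apply: (measurableT_comp (measurable_powR _)); apply: measurableT_comp => //.
  by apply: (@toOmega n); exact: (lift (k := n)).
have i1 : P.-integrable setT (EFin \o (fun w => cos (Z n w) * f w)).
  apply: (integrable_bounded P (M := 1)); first exact: measurable_funM.
  move=> w; have /andP[f0 f1] := f01 w.
  by rewrite normrM mulr_ile1// ?normr_cos_le1// ger0_norm.
have i2 : P.-integrable setT (EFin \o (fun w => cos (Z n w) * expR (neg n w))).
  by apply: (integrable_bounded P (M := 1)) => //; exact: measurable_funM.
rewrite -RintegralB//.
apply: (abs_Rintegral_le P (M := 2)).
- by apply: measurable_funB; exact: measurable_funM.
- move=> w; have /andP[f0 f1] := f01 w; have /andP[e0 e1] := expR_neg n w.
  rewrite -mulrBr normrM (le_trans (ler_piMl _ (normr_cos_le1 _)))//.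
  by rewrite (le_trans (ler_normB _ _))// (ger0_norm f0) (ger0_norm e0); lra.
- exact: measurable_funB.
- move=> w; rewrite -mulrBr normrM (le_trans _ (compensation n w))//.
  exact: ler_piMl (normr_cos_le1 _).
Qed.

Let pos_mono n w : pos n w <= pos n.+1 w.
Proof. by rewrite -subr_ge0 (le_trans _ (compensation n w)). Qed.

Let telescope n :
  (`|\int[P]_w (cos (Z n w) * expR (neg n w)) -
     \int[P]_w (cos (Y w) * expR (- G w))|%:E
   <= \int[P]_w (pos n w)%:E)%E.
Proof.
elim: n => [|n IH].
  have -> : \int[P]_w (cos (Z 0 w) * expR (neg 0 w)) =
      \int[P]_w (cos (Y w) * expR (- G w)).
    apply: eq_Rintegral => w _; rewrite /Z /neg /A !big_ord0 addr0 add0r.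
    by rewrite min_l// oppr_le0.
  by rewrite subrr normr0; apply: integral_ge0 => w _; rewrite lee_fin le_max lexx orbT.
have -> : (\int[P]_w (pos n.+1 w)%:E =
    \int[P]_w (pos n.+1 w - pos n w)%:E + \int[P]_w (pos n w)%:E)%E.
  rewrite -ge0_integralD//=.
  - by apply: eq_integral => w _; rewrite -EFinD subrK.
  - by move=> w _; rewrite lee_fin subr_ge0.
  - by apply/measurable_EFinP; exact: measurable_funB.
  - by move=> w _; rewrite lee_fin le_max lexx orbT.
  - exact/measurable_EFinP.
apply: le_trans (leeD (step n) IH); rewrite -EFinD lee_fin.
by rewrite -[X in `|X| <= _](subrKA (\int[P]_w (cos (Z n w) * expR (neg n w)))) ler_normD.
Qed.

(** If the clock [A n] of the integral is close in mean to a variable [G] known at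
    the initial time, the integral behaves, for this mean, as if a variable of
    conditional characteristic function [expR (- G)] had been added to [Y], whatever
    the initial value [Y]. The mean of [cos (Y) * expR (- G)] is compared with that of
    [cos (Z n) * expR (min (A n - G) 0)], and replacing the latter by [cos (Z n)]
    costs the mean of the negative part of [A n - G]. *)
Theorem chain_cos_bound n c : (forall w, c <= G w) ->
  (`|\int[P]_w cos (Z n w)|%:E <=
   (expR (- c))%:E + \int[P]_w (`|A n w - G w|)%:E)%E.
Proof.
move=> cG; set I := \int[P]_w (cos (Z n w) * expR (neg n w)).
have iI : P.-integrable setT (EFin \o (fun w => cos (Z n w) * expR (neg n w))).
  by apply: (integrable_bounded P (M := 1)) => //; exact: measurable_funM.
have icos : P.-integrable setT (EFin \o (fun w => cos (Z n w))).
  by apply: (integrable_bounded P (M := 1)) => [|?]; [exact: mcos|exact: normr_cos_le1].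
have mGO : measurable_fun setT G by apply: (@toOmega 0).
have mAO : measurable_fun setT (A n) by apply: (@toOmega n); exact: mA.
have mpart : measurable_fun setT (fun w => - neg n w).
  by apply: measurable_funN; apply: (@toOmega n); exact: mneg.
have neg0 w : 0 <= - neg n w by rewrite oppr_ge0 ge_min lexx orbT.
have first_part : (`|\int[P]_w cos (Z n w) - I|%:E <= \int[P]_w (- neg n w)%:E)%E.
  rewrite -RintegralB//; apply: (abs_Rintegral_le P (M := 2)) => //.
  - by apply: measurable_funB => //; exact: measurable_funM.
  - move=> w; rewrite (le_trans (ler_normB _ _))//.
    by have := normr_cos_expR_neg n w; have := normr_cos_le1 (Z n w); lra.
  - move=> w; rewrite -[X in X - _]mulr1 -mulrBr normrM.
    have /andP[e0 e1] := expR_neg n w.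
    rewrite (le_trans (ler_piMl _ (normr_cos_le1 _)))// ger0_norm; last by lra.
    by have := expR_ge1Dx (neg n w); lra.
have last_part : `|\int[P]_w (cos (Y w) * expR (- G w))| <= expR (- c).
  rewrite -lee_fin; apply: le_trans (abs_Rintegral_le P (M := expR (- c)) _ _
    (measurable_cst (expR (- c))) _) _.
  - apply: measurable_funM; last first.
      by apply: measurableT_comp => //; exact: measurable_funN.
    apply: measurable_cos_comp; apply: (@toOmega 0); exact: (lift (k := 0)).
  - move=> w; rewrite normrM (le_trans (ler_piMl _ (normr_cos_le1 _)))//.
    by rewrite ger0_norm ?expR_ge0// ler_expR lerN2.
  - move=> w; rewrite normrM (le_trans (ler_piMl _ (normr_cos_le1 _)))//.
    by rewrite ger0_norm ?expR_ge0// ler_expR lerN2.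
  by rewrite (integral_cst _ _ (expR (- c))%:E)//= [P _]probability_setT mule1.
have -> : (\int[P]_w (`|A n w - G w|)%:E =
    \int[P]_w (- neg n w)%:E + \int[P]_w (pos n w)%:E)%E.
  rewrite -ge0_integralD//=.
  - apply: eq_integral => w _; rewrite -EFinD; congr EFin.
    rewrite /neg /pos; case: (leP (A n w - G w) 0) => h.
      by rewrite ler0_norm// addr0.
    by rewrite gtr0_norm// oppr0 add0r.
  - by move=> w _; rewrite lee_fin.
  - exact/measurable_EFinP.
  - by move=> w _; rewrite lee_fin le_max lexx orbT.
  - exact/measurable_EFinP.
set J := \int[P]_w (cos (Y w) * _) in last_part.
set K := \int[P]_w cos (Z n w) in first_part *.
apply: (@le_trans _ _ (`|K - I| + `|I - J| + `|J|)%:E).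
  have -> : K = K - I + (I - J) + J by ring.
  rewrite lee_fin; apply: (le_trans (ler_normD _ _)); rewrite lerD2r.
  have -> : K - I + (I - J) + J - I = K - I by ring.
  exact: ler_normD.
rewrite !EFinD addeC leeD ?lee_fin// leeD//.
exact: telescope.
Qed.

End chain.

End martingale_bound.

(** * Power functions *)

Section power_estimates.
Context {R : realType}.
Implicit Types (a b p q : R).

Lemma powR_le a b p : 0 <= p -> 0 <= a -> a <= b -> a `^ p <= b `^ p.
Proof.
by move=> p0 a0 ab; apply: ge0_ler_powR; rewrite ?nnegrE// (le_trans a0).
Qed.

Lemma powR_normD_le a b p : 0 <= p -> p <= 2 ->
  `|a + b| `^ p <= 4 * (`|a| `^ p + `|b| `^ p).
Proof.
move=> p0 p2; have two : 2 `^ p <= 4 :> R.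
  by rewrite (le_trans (ler_powR _ p2)) ?ler1n// powR_mulrn// -natrX.
have := powR_ge0 `|a| p; have := powR_ge0 `|b| p.
have ab := ler_normD a b; have [c|c] := leP `|a| `|b|.
  have : `|a + b| `^ p <= (2 * `|b|) `^ p by apply: powR_le => //; lra.
  by rewrite powRM//; have := ler_wpM2r (powR_ge0 `|b| p) two; lra.
have : `|a + b| `^ p <= (2 * `|a|) `^ p by apply: powR_le => //; lra.
by rewrite powRM//; have := ler_wpM2r (powR_ge0 `|a| p) two; lra.
Qed.

(** The [p]-th power of the norm is not subadditive for [p] above 1; either
    [a - b] is small relatively to [b], and the powers differ by a small multiple
    of that of [b], or everything is dominated by the power of [a - b]. *)
Lemma powR_normB_le a b p eta : 0 <= p -> p <= 2 -> 0 < eta -> eta < 1 ->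
  `| `|a| `^ p - `|b| `^ p| <=
    3 * eta * `|b| `^ p + (1 + eta^-1) ^+ 2 * `|a - b| `^ p.
Proof.
move=> p0 p2 eta0 eta1.
have a0 := normr_ge0 a; have b0 := normr_ge0 b; have ab0 := normr_ge0 (a - b).
have iv0 : 0 < eta^-1 by rewrite invr_gt0.
have tri1 : `|a| <= `|a - b| + `|b| by rewrite -[X in `|X| <= _](subrK b) ler_normD.
have tri2 : `|b| <= `|a - b| + `|a|.
  by rewrite distrC -[X in `|X| <= _](subrK a) ler_normD.
have bp := powR_ge0 `|b| p; have abp := powR_ge0 `|a - b| p.
have [ab|ab] := leP `|a - b| (eta * `|b|).
  have up : `|a| `^ p <= (1 + eta) ^+ 2 * `|b| `^ p.
    rewrite (le_trans (powR_le (b := (1 + eta) * `|b|) p0 _ _))//; first by lra.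
    rewrite powRM//; last by lra.
    rewrite ler_wpM2r// -powR_mulrn; last by lra.
    by apply: ler_powR => //; lra.
  have lo : (1 - eta) ^+ 2 * `|b| `^ p <= `|a| `^ p.
    rewrite (le_trans _ (powR_le (a := (1 - eta) * `|b|) p0 _ _))//.
    - rewrite powRM//; last by lra.
      rewrite ler_wpM2r// -powR_mulrn; last by lra.
      by apply: ger_powR => //; lra.
    - by rewrite mulr_ge0//; lra.
    - by lra.
  have up' : (1 + eta) ^+ 2 <= 1 + 3 * eta by nra.
  have lo' : 1 - 3 * eta <= (1 - eta) ^+ 2 by nra.
  have C0 : 0 <= (1 + eta^-1) ^+ 2 * `|a - b| `^ p by rewrite mulr_ge0// sqr_ge0.
  have := ler_wpM2r bp up'; have := ler_wpM2r bp lo'.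
  by rewrite ler_norml; lra.
have ap := powR_ge0 `|a| p.
have bab : `|b| <= eta^-1 * `|a - b| by rewrite mulrC ler_pdivlMr// mulrC ltW.
have key c : 0 <= c -> c <= (1 + eta^-1) * `|a - b| ->
    c `^ p <= (1 + eta^-1) ^+ 2 * `|a - b| `^ p.
  move=> c0 cab; rewrite (le_trans (powR_le p0 c0 cab))//.
  rewrite powRM//; last by lra.
  rewrite ler_wpM2r// -powR_mulrn; last by lra.
  by apply: ler_powR => //; lra.
have := key _ a0; have := key _ b0.
have eb : 0 <= 3 * eta * `|b| `^ p by rewrite !mulr_ge0//; lra.
have -> : `|b| <= (1 + eta^-1) * `|a - b| by lra.
have -> : `|a| <= (1 + eta^-1) * `|a - b| by lra.
by rewrite ler_norml => /(_ isT) ? /(_ isT) ?; lra.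
Qed.

Lemma normr_expR_subr1_le (x M : R) : `|x| <= M -> `|expR x - 1| <= expR M - 1.
Proof.
rewrite ler_norml => /andP[Mx xM]; rewrite ler_norml; apply/andP; split; last first.
  by rewrite lerD2r ler_expR.
have [x0|x0] := leP 0 x.
  have := expR_ge1Dx x; have := expR_ge1Dx M; lra.
have := expR_ge1Dx x; have := expR_ge1Dx (- x); have : expR (- x) <= expR M.
  by rewrite ler_expR; lra.
by lra.
Qed.

(** On [0 < s <= 1] the derivative of [s `^ p] in [p] is [s `^ p * ln s], which is
    bounded by [delta^-1] uniformly in [s] for [p] at least [delta]. *)
Lemma powR_exponent_le (s p q delta v : R) : 0 < s <= 1 -> 0 < delta ->
  delta <= p -> delta <= q -> `|p - q| <= v -> `|s `^ p - s `^ q| <= v / delta.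
Proof.
move=> /andP[s0 s1] d0.
wlog pq : p q / p <= q.
  move=> wl dp dq pqv; have [pq|/ltW qp] := leP p q; first exact: wl.
  by rewrite distrC; apply: wl => //; rewrite distrC.
move=> dp dq pqv; have qpv : q - p <= v by rewrite distrC ger0_norm in pqv; lra.
have l0 : 0 <= - ln s by rewrite oppr_ge0 ln_le0.
have spow x : s `^ x = expR (x * ln s) by rewrite /powR gt_eqF.
have sq : s `^ q = s `^ p * s `^ (q - p).
  by rewrite -powRD ?subrKC//; apply/implyP => _; rewrite gt_eqF.
have e1 : 1 - s `^ (q - p) <= (q - p) * - ln s.
  by rewrite spow; have := expR_ge1Dx ((q - p) * ln s); lra.
have e0 : s `^ (q - p) <= 1 by rewrite spow expR_le1; nra.
have sp1 : s `^ p <= s `^ delta by apply: ger_powR => //; rewrite s0.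
have key : s `^ delta * - ln s <= delta^-1.
  rewrite -[leRHS]mul1r ler_pdivlMr// spow.
  have := expR_ge1Dx (- (delta * ln s)); rewrite expRN => h.
  have E := expR_gt0 (delta * ln s).
  have h2 : - (delta * ln s) <= (expR (delta * ln s))^-1 by lra.
  have := ler_wpM2l (ltW E) h2; rewrite divff ?gt_eqF//; lra.
have p0 := powR_ge0 s p; have d0' := powR_ge0 s delta.
have qp0 : 0 <= q - p by rewrite subr_ge0.
have v0 : 0 <= v by lra.
rewrite ger0_norm sq -{1}[s `^ p]mulr1 -mulrBr; last by rewrite mulr_ge0// subr_ge0.
apply: (le_trans (ler_wpM2l p0 e1)).
apply: (@le_trans _ _ ((q - p) * (s `^ delta * - ln s))).
  by rewrite mulrCA ler_wpM2l// ler_wpM2r.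
by apply: ler_pM => //; rewrite mulr_ge0.
Qed.

(** Changing the exponent within [v] perturbs [y `^ p] on [0 < y <= h] by a
    small multiple of [h `^ p] as soon as [v] and [v * ln h] are small: after
    scaling [y] by [h] only the factor [h `^ (q - p)] feels the size of [h]. *)
Lemma powR_scaled_exponent_le (h y p q delta v : R) : 0 < y -> y <= h ->
  0 < delta -> delta <= p -> delta <= q -> `|q - p| <= v ->
  `|y `^ q - y `^ p| <= h `^ p * (expR (v * `|ln h|) - 1 + v / delta).
Proof.
move=> y0 yh d0 dp dq qp.
have h0 : 0 < h by apply: lt_le_trans yh.
pose s := y / h; have s0 : 0 < s by rewrite divr_gt0.
have s1 : s <= 1 by rewrite ler_pdivrMr// mul1r.
have yE : y = h * s by rewrite /s mulrCA divff ?gt_eqF// mulr1.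
have hpow x : h `^ x = expR (x * ln h) by rewrite /powR gt_eqF.
rewrite {}yE; clearbody s; rewrite !powRM ?(ltW h0) ?(ltW s0)//.
have -> : h `^ q = h `^ p * h `^ (q - p).
  by rewrite -powRD ?subrKC//; apply/implyP => _; rewrite gt_eqF.
have -> : h `^ p * h `^ (q - p) * s `^ q - h `^ p * s `^ p =
  h `^ p * ((h `^ (q - p) - 1) * s `^ q + (s `^ q - s `^ p)) by ring.
rewrite normrM (ger0_norm (powR_ge0 _ _)) ler_wpM2l ?powR_ge0//.
apply: (le_trans (ler_normD _ _)); apply: lerD; last first.
  by apply: powR_exponent_le => //; rewrite s0.
rewrite normrM (ger0_norm (powR_ge0 s _)).
have sq1 : s `^ q <= 1.
  by rewrite -[leRHS](powRr0 s) ger_powR// ?s0//; lra.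
apply: (le_trans (ler_wpM2l (normr_ge0 _) sq1)); rewrite mulr1 hpow.
by apply: normr_expR_subr1_le; rewrite normrM ler_wpM2r.
Qed.

Lemma pos_powR_ge0 (x c : R) : 0 <= pos_powR x c.
Proof. by rewrite /pos_powR; case: ifP => // _; exact: powR_ge0. Qed.

Lemma pos_powR_continuous (c : R) : 0 < c -> continuous (fun x => pos_powR x c).
Proof.
move=> c0 x; have [x0|x0|->] := ltgtP x 0.
- rewrite /continuous_at {2}/pos_powR ltNge (ltW x0)/=.
  apply/cvgrPdist_lt => e e0; near=> z; rewrite /pos_powR.
  have z0 : z <= 0 by near: z; exact: lt_le_nbhsl.
  by rewrite (le_gtF z0) subrr normr0.
- rewrite /continuous_at {2}/pos_powR x0.
  apply: (@cvg_trans _ ((fun y => y `^ c) @ x)).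
    apply: near_eq_cvg; near=> z; rewrite /pos_powR.
    by have -> : 0 < z by near: z; exact: lt_nbhsr.
  have : derivable (@powR R ^~ c) x 1 by apply: derivable_powR; rewrite in_itv/= x0.
  by move=> /derivable1_diffP/differentiable_continuous.
- apply/cvgrPdist_lt => e e0; near=> y; rewrite {1}/pos_powR ltxx sub0r normrN.
  rewrite ger0_norm ?pos_powR_ge0// /pos_powR; case: ifPn => // y0.
  have ye : y < e `^ c^-1.
    by near: y; apply: lt_nbhsl; exact: powR_gt0.
  have := gt0_ltr_powR c0 (ltW y0 : y \in Num.nneg) (powR_ge0 e c^-1) ye.
  by rewrite -powRrM mulVf ?gt_eqF// powRr1 ?(ltW e0).
Unshelve. all: by end_near. Qed.

Lemma integral_pos_powR (t0 t b beta : R) : t0 < t -> t <= b -> 0 < beta ->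
  (\int[lebesgue_measure]_(x in `]t0, b]) (pos_powR (t - x) beta)%:E =
  ((t - t0) `^ (beta + 1) / (beta + 1))%:E)%E.
Proof.
move=> t0t tb beta0; have c0 : 0 < beta + 1 by lra.
have cont (g : R) : 0 < g -> continuous (fun x : R => pos_powR (t - x) g).
  move=> g0 x.
  apply: (@continuous_comp _ _ _ (fun x => t - x) (fun y => pos_powR y g)).
    by apply: cvgB; [exact: cvg_cst|exact: cvg_id].
  exact: pos_powR_continuous.
have mpos : measurable_fun setT (fun x : R => pos_powR (t - x) beta).
  by apply: continuous_measurable_fun; exact: cont.
have -> : `]t0, b]%classic = `]t0, t] `|` `]t, b] :> set R.
  by rewrite -itv_bndbnd_setU// bnd_simp// ltW.
rewrite ge0_integral_setU//=; last 3 first.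
- by apply/measurable_EFinP; exact: measurable_funTS.
- by move=> x _; rewrite lee_fin pos_powR_ge0.
- apply/disj_setPRL => x /=; rewrite !in_itv/= => /andP[tx _] /andP[_]; lra.
rewrite [X in (_ + X)%E]integral0_eq ?adde0; last first.
  move=> x /=; rewrite in_itv/= => /andP[tx _].
  by rewrite /pos_powR subr_gt0 ltNge (ltW tx).
rewrite integral_itv_obnd_cbnd; last first.
  by apply/measurable_EFinP; exact: measurable_funTS.
pose F x := - ((t - x) `^ (beta + 1) / (beta + 1)).
have dF x : x < t -> is_derive x 1 F (pos_powR (t - x) beta).
  move=> xt; rewrite /pos_powR subr_gt0 xt /F.
  have d1 : is_derive x 1 (fun x => t - x) (-1).
    by apply: is_derive_eq; rewrite add0r mul1r.
  have d2 : is_derive (t - x) 1 (@powR R ^~ (beta + 1)) ((beta + 1) * (t - x) `^ (beta + 1 - 1)).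
    by apply: is_derive1_powR; rewrite subr_gt0.
  have d3 := is_deriveZ (- (beta + 1)^-1)
    (@is_derive1_comp R (@powR R ^~ (beta + 1)) (fun x => t - x) x _ _ d2 d1).
  have -> : (fun x0 : R => - ((t - x0) `^ (beta + 1) / (beta + 1))) =
      (- (beta + 1)^-1) \*: ((@powR R ^~ (beta + 1)) \o (fun x => t - x)).
    by apply/funext => z /=; rewrite /GRing.scale/= mulNr mulrC.
  apply: (is_derive_eq d3); rewrite addrK /GRing.scale/=; field.
  exact: lt0r_neq0.
rewrite (@continuous_FTC2 _ _ F)//.
- rewrite /F subrr powR0 ?gt_eqF// mul0r oppr0 sub0e -EFinN opprK. by [].
- exact/continuous_subspaceT/cont.
- split.
  + by move=> x; rewrite in_itv/= => /andP[_ xt]; have [] := dF x xt.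
  + apply: cvg_at_right_filter; apply: differentiable_continuous.
    by apply/derivable1_diffP; have [] := dF t0 t0t.
  + rewrite {2}/F subrr powR0 ?gt_eqF// mul0r oppr0.
    apply: (@cvg_trans _ ((fun x => - (pos_powR (t - x) (beta + 1) / (beta + 1))) @ t^'-)).
      apply: near_eq_cvg; near=> x; rewrite /F /pos_powR subr_gt0.
      by have -> : x < t by near: x; exact: nbhs_left_lt.
    have lim0 : pos_powR (t - x) (beta + 1) @[x --> t^'-] --> 0.
      apply: cvg_at_left_filter; have := cont _ c0 t.
      by rewrite /continuous_at {2}/pos_powR subrr ltxx.
    have limc : (beta + 1)^-1 @[_ --> t^'-] --> (beta + 1)^-1 by exact: cvg_cst.
    have := cvgN (cvgM lim0 limc).
    by rewrite mul0r oppr0; exact.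
- move=> x; rewrite in_itv/= => /andP[_ xt]; rewrite derive1E.
  by have dFx := dF x xt; rewrite derive_val.
Unshelve. all: by end_near. Qed.

End power_estimates.

(** * Simple processes on a common chain *)

Section simple_on_chain.
Context {R : realType} {d : measure_display} {Omega : measurableType d}.
Variables (P : probability Omega R) (alpha : R) (L : R -> Omega -> R).
Hypothesis L_levy : symmetric_stable_levy P alpha L.

Let mL := levy_measurable L_levy.

(** The last term is repeated, so that [r] is monotone on all of [nat]. *)
Lemma sorted_chain (s : seq R) : s != [::] -> exists (r : nat -> R) (N : nat),
  [/\ {homo r : i j / (i <= j)%N >-> i <= j}, forall i, r i \in s &
      forall z, z \in s -> exists2 i, (i <= N)%N & r i = z].
Proof.
move=> s0; pose N := (size s).-1.
have sN : size (sort <=%R s) = N.+1 by rewrite size_sort prednK// lt0n size_eq0.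
have mN i : (minn i N < size (sort <=%R s))%N by rewrite sN ltnS geq_minr.
exists (fun i => nth 0 (sort <=%R s) (minn i N)), N; split.
- move=> i j ij; apply: le_sorted_leq_nth; rewrite ?inE ?sort_le_sorted//.
  by rewrite leq_min geq_minr andbT (leq_trans (geq_minl _ _)).
- by move=> i; rewrite -(mem_sort <=%R) mem_nth.
move=> z zs; exists (index z (sort <=%R s)).
  by rewrite -ltnS -sN index_mem mem_sort.
rewrite (minn_idPl _) ?nth_index ?mem_sort//.
by rewrite -ltnS -sN index_mem mem_sort.
Qed.

Section chain.
Variables (r : nat -> R) (N : nat).
Hypothesis r_homo : {homo r : i j / (i <= j)%N >-> i <= j}.

Let on_chain z := exists2 i, (i <= N)%N & r i = z.

Lemma chain_gap z j : on_chain z -> z < r j.+1 -> z <= r j.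
Proof.
move=> [i _ <-] ij; apply: r_homo; rewrite -ltnS ltnNge.
by apply: contraL ij => /r_homo; rewrite -leNgt.
Qed.

Lemma chain_itv z x j : on_chain z -> r j < x <= r j.+1 ->
  (z < x) = (z < r j.+1).
Proof.
move=> cz /andP[jx xj]; apply/idP/idP => [zx|zj]; first exact: lt_le_trans xj.
exact: le_lt_trans (chain_gap cz zj) jx.
Qed.

(** Both sides telescope after the points of the chain are clipped to [c, e]; a
    step of the chain lies either inside or outside of [c, e], which is why
    testing its right end is enough. *)
Lemma chain_increment c e w : on_chain c -> on_chain e -> c <= e ->
  increment L c e w =
  \sum_(j < N) \1_(`]c, e]%classic) (r j.+1) * increment L (r j) (r j.+1) w.
Proof.
move=> hc he ce; pose clip x := Num.max c (Num.min e x).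
have clipN : clip (r N) = e.
  have eN : e <= r N by have [i iN <-] := he; exact: r_homo.
  by rewrite /clip (min_idPl eN) (max_idPr ce).
have clip0 : clip (r 0%N) = c.
  have c0 : r 0%N <= c by have [i iN <-] := hc; exact: r_homo.
  by rewrite /clip (min_idPr (le_trans c0 ce)) (max_idPl c0).
rewrite /increment -{1}clipN -{1}clip0.
rewrite -(telescope_sumr (fun j => L (clip (r j)) w) (leq0n N)) big_mkord.
apply: eq_bigr => j _; rewrite indicE mem_setE in_itv/=.
have rj : r j <= r j.+1 by exact: r_homo.
have [cj|jc] := ltP c (r j.+1); last first.
  rewrite mul0r /clip (max_idPl _) ?ge_min ?jc ?orbT//.
  by rewrite (max_idPl _) ?subrr// ge_min (le_trans rj jc) orbT.
have cj' := chain_gap hc cj.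
have [je|ej] := leP (r j.+1) e.
  by rewrite mul1r /clip (min_idPr je) (max_idPr (ltW cj))
    (min_idPr (le_trans rj je)) (max_idPr cj').
by rewrite mul0r /clip (min_idPl (ltW ej)) (min_idPl (chain_gap he ej)) subrr.
Qed.

Section simple.
Variables (a b : R) (S : simple_process (natural_filtration L) a b).
Hypothesis S_chain : forall k, (k <= sp_size S)%N -> on_chain (sp_point S k).

Lemma sp_fun_chain x j w : r j < x <= r j.+1 ->
  sp_fun S x w = sp_fun S (r j.+1) w.
Proof.
move=> jx; apply: eq_bigr => k _; congr (_ * _).
rewrite !indicE !mem_setE !in_itv/=; have jj : r j < r j.+1 <= r j.+1.
  by rewrite lexx andbT; case/andP: jx; exact: lt_le_trans.
have ck := S_chain (ltnW (ltn_ord k)); have ck1 := S_chain (ltn_ord k).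
by rewrite !leNgt !(chain_itv ck jx) !(chain_itv ck1 jx).
Qed.

(** The value after [r j] is decided by time [r j]: the coefficient on an interval
    of the process that meets ]r j, r j.+1] is known at the left end of that
    interval, a point of the chain that does not exceed [r j]. *)
Lemma sp_fun_chain_meas j :
  meas_wrt (natural_filtration L (r j)) (sp_fun S (r j.+1)).
Proof.
apply/meas_wrtP; apply: measurable_sum => k.
rewrite indicE mem_setE in_itv/=; case: ltP => [kj|_]; last first.
  rewrite [X in measurable_fun _ X](_ : _ = cst 0); first exact: measurable_cst.
  by apply/funext => w; rewrite /= mulr0.
apply: measurable_funM => //; apply/meas_wrtP.
apply: (@sub_meas_wrt _ _ _ (natural_filtration L (sp_point S k))).
  apply: natural_filtration_mono; apply: chain_gap kj.
  by apply: S_chain; exact: ltnW.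
exact: sp_meas.
Qed.

Lemma sp_integral_chain w : sp_integral L S w =
  \sum_(j < N) sp_fun S (r j.+1) w * increment L (r j) (r j.+1) w.
Proof.
rewrite /sp_integral.
under eq_bigr => k _ do rewrite (chain_increment w (S_chain (ltnW (ltn_ord k)))
  (S_chain (ltn_ord k)) (ltW (sp_lt (ltn_ord k)))) mulr_sumr.
rewrite exchange_big/=; apply: eq_bigr => j _; rewrite /sp_fun mulr_suml.
by apply: eq_bigr => k _; rewrite mulrA.
Qed.

End simple.
End chain.

Lemma sp_point_itv a b (S : simple_process (natural_filtration L) a b) k :
  (k <= sp_size S)%N -> a <= sp_point S k <= b.
Proof.
have lo j : (j <= sp_size S)%N -> a <= sp_point S j.
  elim: j => [_|j IH jS]; first by rewrite sp_first.
  by rewrite (le_trans (IH (ltnW jS)))// ltW// sp_lt.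
have hi j : (j <= sp_size S)%N -> sp_point S (sp_size S - j) <= b.
  elim: j => [_|j IH jS]; first by rewrite subn0 sp_last.
  apply: le_trans (IH (ltnW jS)).
  have <- : (sp_size S - j.+1).+1 = (sp_size S - j)%N by rewrite subnSK.
  by rewrite ltW// sp_lt// ltn_subrL/= (leq_ltn_trans _ jS).
move=> kS; rewrite lo//=; have := hi _ (leq_subr k (sp_size S)).
by rewrite subKn.
Qed.

Lemma integral_step (r c : nat -> R) (f : R -> R) n :
  {homo r : i j / (i <= j)%N >-> i <= j} -> (forall k, 0 <= c k) ->
  (forall k x, r k < x <= r k.+1 -> f x = c k) -> measurable_fun setT f ->
  (\int[lebesgue_measure]_(x in `]r 0%N, r n]) (f x)%:E =
   (\sum_(k < n) (r k.+1 - r k) * c k)%:E)%E.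
Proof.
move=> hr c0 fc mf; elim: n => [|n IH].
  by rewrite set_itvoc0 integral_set0 big_ord0.
have -> : `]r 0%N, r n.+1]%classic = `]r 0%N, r n] `|` `]r n, r n.+1] :> set R.
  by rewrite -itv_bndbnd_setU// bnd_simp hr.
have f0 x : (`]r 0%N, r n] `|` `]r n, r n.+1]) x -> (0 <= (f x)%:E)%E.
  move=> xr; rewrite lee_fin.
  suff [k ->] : exists k, f x = c k by [].
  have : (exists k, r k < x <= r k.+1).
    move: xr => []/=; rewrite in_itv/= => /andP[]; last by exists n; apply/andP.
    move: n {IH} => n; elim: n => [x0 /(lt_le_trans x0)|n IH x0 xn].
      by rewrite ltxx.
    have [xn'|xn'] := leP x (r n); first exact: IH.
    by exists n; rewrite xn' xn.
  by move=> [k /fc]; exists k.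
rewrite ge0_integral_setU//=.
- rewrite IH big_ord_recr/= EFinD; congr (_ + _)%E.
  under eq_integral => x.
    rewrite inE/= in_itv/= => /fc ->; over.
  rewrite integral_cst//= lebesgue_measure_itv/= lte_fin.
  case: ltP => [_|rn]; first by rewrite -EFinD -EFinM mulrC.
  by have -> : r n.+1 = r n; [apply/le_anti; rewrite rn hr|rewrite subrr mul0r mule0].
- by apply/measurable_EFinP; exact: measurable_funTS.
- apply/disj_setPRL => x /=; rewrite !in_itv/= => /andP[nx _] /andP[_ xn].
  by have := lt_le_trans nx xn; rewrite ltxx.
Qed.

Lemma measurable_sp_fun a b (S : simple_process (natural_filtration L) a b) w :
  measurable_fun setT (fun x => sp_fun S x w).
Proof. by apply: measurable_sum => k; exact: measurable_funM. Qed.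

Lemma measurable_sp_integral a b (S : simple_process (natural_filtration L) a b) :
  measurable_fun setT (sp_integral L S).
Proof.
apply: measurable_sum => k; apply: measurable_funM.
  apply: meas_wrt_measurable (sp_meas (ltn_ord k)).
  exact: natural_filtration_measurable.
exact: increment_measurable.
Qed.

(** Along a chain that contains [t0] and the points of both processes, the part of
    the integral before [t0] is known at [t0] and becomes the initial value of
    [chain_cos_bound]; there the clock is the energy after [t0]. *)
Theorem simple_diff_cos_bound (a b t0 c : R)
    (S1 S2 : simple_process (natural_filtration L) a b) (gamma G : Omega -> R) :
  a <= t0 -> t0 <= b ->
  meas_wrt (natural_filtration L t0) gamma ->
  meas_wrt (natural_filtration L t0) G ->
  0 <= c -> (forall w, c <= G w) ->
  exists A : Omega -> R, [/\ measurable_fun setT A,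
    forall w, ((A w)%:E = \int[lebesgue_measure]_(x in `]t0, b])
      (`|gamma w * (sp_fun S1 x w - sp_fun S2 x w)| `^ alpha)%R%:E)%E &
    (`|\int[P]_w cos (gamma w * (sp_integral L S1 w - sp_integral L S2 w))|%:E
     <= (expR (- c))%:E + \int[P]_w (`|A w - G w|)%:E)%E].
Proof.
move=> at0 t0b mgamma mG c0 cG.
pose s := t0 :: [seq sp_point S1 k | k <- iota 0 (sp_size S1).+1] ++
                [seq sp_point S2 k | k <- iota 0 (sp_size S2).+1].
have [r [N [hr rs sr]]] := @sorted_chain s isT.
have ch1 k : (k <= sp_size S1)%N -> exists2 i, (i <= N)%N & r i = sp_point S1 k.
  move=> kS; apply: sr; rewrite inE mem_cat map_f ?orbT// mem_iota add0n ltnS kS.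
  by [].
have ch2 k : (k <= sp_size S2)%N -> exists2 i, (i <= N)%N & r i = sp_point S2 k.
  move=> kS; apply: sr; rewrite inE mem_cat orbC (map_f (sp_point S2)) ?orbT//.
  by rewrite mem_iota add0n ltnS kS.
have rb i : r i <= b.
  have := rs i; rewrite inE mem_cat => /or3P[/eqP -> //|/mapP[k + ->]|/mapP[k + ->]];
  by rewrite mem_iota add0n ltnS => /sp_point_itv/andP[].
have [p pN rp] : exists2 i, (i <= N)%N & r i = t0 by apply: sr; rewrite inE eqxx.
have rN : r N = b.
  apply/le_anti; rewrite rb/= -(sp_last S1).
  by have [i iN <-] := ch1 _ (leqnn _); exact: hr.
pose f j w := sp_fun S1 (r j.+1) w - sp_fun S2 (r j.+1) w.
have mf j : meas_wrt (natural_filtration L (r j)) (f j).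
  apply/meas_wrtP; apply: measurable_funB; apply/meas_wrtP; exact: (@sp_fun_chain_meas r N).
pose r' k := r (p + k)%N.
have hr' : {homo r' : i j / (i <= j)%N >-> i <= j}.
  by move=> i j ij; apply: hr; rewrite leq_add2l.
pose xi k w := gamma w * f (p + k)%N w.
pose Y w := gamma w * \sum_(j < p) f j w * increment L (r j) (r j.+1) w.
have mxi k : meas_wrt (natural_filtration L (r' k)) (xi k).
  apply/meas_wrtP; apply: measurable_funM; apply/meas_wrtP; last exact: mf.
  apply: sub_meas_wrt mgamma; apply: natural_filtration_mono.
  by rewrite -rp; apply: hr; rewrite leq_addr.
have r'0 : r' 0%N = t0 by rewrite /r' addn0.
have mY : meas_wrt (natural_filtration L (r' 0%N)) Y.
  rewrite r'0; apply/meas_wrtP; apply: measurable_funM; first exact/meas_wrtP.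
  apply: measurable_sum => j; apply: measurable_funM; apply/meas_wrtP.
    apply: sub_meas_wrt (mf j); apply: natural_filtration_mono.
    by rewrite -rp; apply: hr; exact: ltnW.
  by apply: increment_meas_wrt; rewrite -rp; apply: hr => //; exact: ltnW.
have mG' : meas_wrt (natural_filtration L (r' 0%N)) G by rewrite r'0.
have G0 w : 0 <= G w by rewrite (le_trans c0).
have mLr j : measurable_fun setT (f j).
  by apply: meas_wrt_measurable (mf j); exact: natural_filtration_measurable.
have mgammaO : measurable_fun setT gamma.
  by apply: meas_wrt_measurable mgamma; exact: natural_filtration_measurable.
pose A w := \sum_(k < N - p) (r' k.+1 - r' k) * `|xi k w| `^ alpha.
exists A; split.
- apply: measurable_sum => k; apply: measurable_funM => //.
  apply: (measurableT_comp (measurable_powR _)); apply: measurableT_comp => //.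
  exact: measurable_funM.
- move=> w; rewrite /A; set g := fun x => `|gamma w * (sp_fun S1 x w - sp_fun S2 x w)| `^ alpha.
  have -> : `]t0, b]%classic = [set` `]r' 0%N, r' (N - p)%N]] :> set R.
    by rewrite r'0 /r' subnKC// rN.
  apply/esym; apply: (@integral_step r' (fun k => `|xi k w| `^ alpha) g) => //.
  + move=> k x; rewrite /r' addnS => kx; rewrite /g /xi /f.
    by rewrite (@sp_fun_chain r N hr _ _ _ ch1 _ _ _ kx) (@sp_fun_chain r N hr _ _ _ ch2 _ _ _ kx).
  + apply: (measurableT_comp (measurable_powR _)); apply: measurableT_comp => //.
    by apply: measurable_funM => //; apply: measurable_funB; exact: measurable_sp_fun.
have := chain_cos_bound L_levy hr' mxi mY mG' G0 (N - p) cG.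
congr (`|_|%:E <= _)%E; apply: eq_Rintegral => w _; congr cos.
rewrite (sp_integral_chain hr ch1) (sp_integral_chain hr ch2) -sumrB /Y.
under [in RHS]eq_bigr do rewrite -mulrBl.
have -> : \sum_(k < N - p) xi k w * increment L (r' k) (r' k.+1) w =
    gamma w * \sum_(k < N - p) f (p + k)%N w * increment L (r' k) (r' k.+1) w.
  by rewrite mulr_sumr; apply: eq_bigr => k _; rewrite /xi mulrA.
rewrite -mulrDr; congr (_ * _).
rewrite -[in RHS](subnKC pN) big_split_ord/=; congr (_ + _).
by apply: eq_bigr => k _; rewrite /r' addnS.
Qed.

End simple_on_chain.

(** * Small balls and characteristic functions *)

Section small_balls.
Context {R : realType} {d : measure_display} {Omega : measurableType d}.
Variable P : probability Omega R.

Lemma cos_lipschitz (a b : R) : `|cos a - cos b| <= `|a - b|.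
Proof.
wlog ba : a b / b <= a.
  by move=> wl; have [ba|/ltW ab] := leP b a; [exact: wl|rewrite distrC [leRHS]distrC wl].
have dcos x : x \in `]b, a[ -> is_derive x 1 (@cos R) (- sin x).
  by move=> _; exact: is_derive_cos.
have ccos : {within `[b, a], continuous (@cos R)}.
  by apply: continuous_subspaceT => x; exact: continuous_cos.
have [c _ ->] := MVT_segment ba dcos ccos.
by rewrite normrM normrN ler_piMl// sin_max.
Qed.

Lemma integrable_Rsum (I : Type) (s : seq I) (f : I -> Omega -> R) :
  (forall i, P.-integrable setT (EFin \o f i)) ->
  P.-integrable setT (EFin \o (fun w => \sum_(i <- s) f i w)).
Proof.
move=> fi; have -> : EFin \o (fun w => \sum_(i <- s) f i w) =
    (fun w => (\sum_(i <- s) (EFin \o f i) w)%E).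
  by apply/funext => w /=; rewrite -sumEFin.
exact: integrable_sum.
Qed.

Lemma Rintegral_sum (I : Type) (s : seq I) (f : I -> Omega -> R) :
  (forall i, P.-integrable setT (EFin \o f i)) ->
  \int[P]_w (\sum_(i <- s) f i w) = \sum_(i <- s) \int[P]_w f i w.
Proof.
move=> fi; elim: s => [|i s IH].
  rewrite big_nil -[RHS](mul0r (fine (P setT))) -Rintegral_cst//.
  by apply: eq_Rintegral => w _; rewrite big_nil.
rewrite big_cons -IH -RintegralD//.
  by apply: eq_Rintegral => w _; rewrite big_cons.
exact: integrable_Rsum.
Qed.

(** Expanding the square of a trigonometric polynomial with frequencies
    [theta, 2 theta, ..] : the diagonal contributes [N] and every other term is
    the mean of two values of the characteristic function at frequencies between
    [theta] and [2 N theta].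
    Near the origin the polynomial is of size [N], hence its square [N ^ 2]. *)
Lemma small_ball (D : Omega -> R) (N : nat) (theta c : R) :
  measurable_fun setT D -> (0 < N)%N -> 0 < theta -> 0 <= c ->
  (forall k : 'I_(N.*2), `|\int[P]_w cos (k.+1%:R * theta * D w)| <= c) ->
  (P [set w | (`|D w| <= (2 * N%:R * theta)^-1)%R] <= (4 / N%:R + 4 * c)%:E)%E.
Proof.
move=> mD N0 th0 c0 bound.
have NR : 0 < N%:R :> R by rewrite ltr0n.
have mcos u : measurable_fun setT (fun w => cos (u * D w)).
  by apply: measurable_cos_comp; exact: measurable_funM.
have icos u : P.-integrable setT (EFin \o (fun w => cos (u * D w))).
  by apply: (integrable_bounded P (M := 1)) => // w; exact: normr_cos_le1.
have bound' (k : nat) : (0 < k)%N -> (k <= N.*2)%N ->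
    `|\int[P]_w cos (k%:R * theta * D w)| <= c.
  by case: k => // k _ kN; exact: (bound (Ordinal kN)).
pose T w := (\sum_(j < N) cos (j.+1%:R * theta * D w)) ^+ 2.
pose t (i j : 'I_N) w := cos (i.+1%:R * theta * D w) * cos (j.+1%:R * theta * D w).
have mt i j : measurable_fun setT (t i j) by exact: measurable_funM.
have it i j : P.-integrable setT (EFin \o t i j).
  apply: (integrable_bounded P (M := 1)) => // w.
  by rewrite normrM mulr_ile1// normr_cos_le1.
have TE w : T w = \sum_(i < N) \sum_(j < N) t i j w.
  by rewrite /T expr2 big_distrlr.
have iT : P.-integrable setT (EFin \o T).
  have -> : T = (fun w => \sum_(i < N) \sum_(j < N) t i j w) by apply/funext.
  by apply: integrable_Rsum => i; exact: integrable_Rsum.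
have tle i j : \int[P]_w t i j w <= (i == j)%:R + c.
  have [->|ij] := eqVneq i j.
    rewrite (@le_trans _ _ 1) ?lerDl//.
    rewrite -[leRHS](_ : \int[P]_w (cst 1 w) = 1); last first.
      by rewrite Rintegral_cst//= [P _]probability_setT mulr1.
    apply: le_Rintegral => //.
      by apply: (integrable_bounded P (M := 1)) => // w; rewrite normr1.
    move=> w _; rewrite (le_trans (ler_norm _))// normrM mulr_ile1//;
      exact: normr_cos_le1.
  have ijE w : t i j w = 2^-1 * (cos ((i.+1 + j.+1)%:R * theta * D w) +
      cos (`|i - j|%N%:R * theta * D w)).
    have -> : cos (`|i - j|%N%:R * theta * D w) =
        cos (i.+1%:R * theta * D w - j.+1%:R * theta * D w).
      have [ij'|ji] := leqP i j.
        rewrite -[RHS]cosN; congr cos.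
        by rewrite distnEr// natrB// -!natr1; ring.
      congr cos; rewrite distnEl ?(ltnW ji)// natrB ?(ltnW ji)// -!natr1; ring.
    rewrite natrD !mulrDl cosD cosB /t; by field.
  rewrite mulr0n add0r.
  have -> : \int[P]_w t i j w = \int[P]_w (2^-1 * (cos ((i.+1 + j.+1)%:R * theta * D w) +
      cos (`|i - j|%N%:R * theta * D w))).
    by apply: eq_Rintegral => w _; exact: ijE.
  rewrite RintegralZl//; last first.
    have -> : EFin \o (fun w => cos ((i.+1 + j.+1)%:R * theta * D w) +
      cos (`|i - j|%N%:R * theta * D w)) =
      (fun w => ((EFin \o (fun w => cos ((i.+1 + j.+1)%:R * theta * D w))) w +
      (EFin \o (fun w => cos (`|i - j|%N%:R * theta * D w))) w)%E) by [].
    exact: integrableD.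
  rewrite RintegralD//.
  have h1 := bound' (i.+1 + j.+1)%N isT.
  have h1' : (i.+1 + j.+1 <= N.*2)%N by rewrite -addnn leq_add.
  have h2 : (0 < `|i - j|)%N by rewrite lt0n distn_eq0.
  have h2' : (`|i - j| <= N.*2)%N.
    by have := ltn_ord i; have := ltn_ord j; rewrite -addnn; lia.
  have := h1 h1'; have := bound' _ h2 h2'.
  by rewrite !ler_norml => /andP[_ ?] /andP[_ ?]; lra.
have ETle : \int[P]_w T w <= N%:R + c * N%:R ^+ 2.
  under eq_Rintegral do rewrite TE.
  rewrite (Rintegral_sum _ (f := fun i w => \sum_(j < N) t i j w)); last first.
    by move=> i; exact: integrable_Rsum.
  apply: (@le_trans _ _ (\sum_(i < N) \sum_(j < N) ((i == j)%:R + c))).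
    apply: ler_sum => i _; rewrite Rintegral_sum//; apply: ler_sum => j _; exact: tle.
  have -> : \sum_(i < N) \sum_(j < N) ((i == j)%:R + c) =
      \sum_(i < N) (1 + c * N%:R).
    apply: eq_bigr => i _; rewrite big_split/= sumr_const card_ord mulr_natr.
    by rewrite (bigD1 i)//= eqxx big1 ?addr0// => j; rewrite eq_sym => /negbTE ->.
  by rewrite sumr_const card_ord -[X in X <= _]mulr_natr; lra.
set E := [set w | _].
have mE : measurable E.
  have -> : E = (fun w => `|D w|) @^-1` `]-oo, (2 * N%:R * theta)^-1].
    by apply/seteqP; split => w /=; rewrite in_itv.
  by rewrite -[X in measurable X]setTI; apply: (measurableT_comp _ mD).
have ET w : E w -> N%:R ^+ 2 / 4 <= T w.
  rewrite /E/= => Dw.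
  have term (j : 'I_N) : 2^-1 <= cos (j.+1%:R * theta * D w).
    have : `|cos (j.+1%:R * theta * D w) - cos 0| <= 2^-1.
      rewrite (le_trans (cos_lipschitz _ _))// subr0 !normrM (ger0_norm (ltW th0)).
      rewrite ger0_norm// (@le_trans _ _ (N%:R * theta * (2 * N%:R * theta)^-1))//.
        by apply: ler_pM => //; rewrite ?mulr_ge0// ?ler_pM// ?ler_nat ?ltW.
      have -> : N%:R * theta * (2 * N%:R * theta)^-1 = 2^-1.
        by field; rewrite !gt_eqF.
      by [].
    by rewrite cos0 ler_norml => /andP[? _]; lra.
  have sumle : N%:R / 2 <= \sum_(j < N) cos (j.+1%:R * theta * D w).
    rewrite (le_trans _ (ler_sum _ (fun j _ => term j)))// sumr_const card_ord.
    by rewrite -(mulr_natr 2^-1 N) mulrC.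
  rewrite /T; have -> : N%:R ^+ 2 / 4 = (N%:R / 2) ^+ 2 :> R by field.
  by rewrite ler_sqr ?nnegrE// ?divr_ge0// (le_trans _ sumle)// divr_ge0.
have key : ((N%:R ^+ 2 / 4)%:E * P E <= (N%:R + c * N%:R ^+ 2)%:E)%E.
  rewrite -integral_cst//; apply: (@le_trans _ _ (\int[P]_(w in E) (T w)%:E)%E).
    apply: ge0_le_integral => //=.
    by apply: measurable_funTS; case/integrableP: iT.
  apply: (@le_trans _ _ (\int[P]_w (T w)%:E)%E).
    apply: ge0_subset_integral => //; first by case/integrableP: iT.
    by move=> w _; rewrite lee_fin sqr_ge0.
  rewrite -(@fineK _ (\int[P]_w (T w)%:E)%E) ?lee_fin//.
  exact: integrable_fin_num.
have Pfin : P E \is a fin_num by rewrite fin_num_measure.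
rewrite -(fineK Pfin) lee_fin; move: key; rewrite -(fineK Pfin) -EFinM lee_fin => key.
rewrite -(ler_pM2l (_ : 0 < N%:R ^+ 2 / 4)); last by rewrite divr_gt0// exprn_gt0.
rewrite (le_trans key)//.
have -> : N%:R ^+ 2 / 4 * (4 / N%:R + 4 * c) = N%:R + c * N%:R ^+ 2 :> R.
  by field; rewrite gt_eqF.
by [].
Qed.

(** If the characteristic functions of [D n] are eventually small at high
    frequencies, the laws of [D n] give little mass to small balls, uniformly for
    large [n], and [D n] cannot tend to zero with positive probability. *)
Theorem negligible_cvg0 (D : nat -> Omega -> R) (psi : R -> R) :
  (forall n, measurable_fun setT (D n)) ->
  (forall u e, 0 < u -> 0 < e -> \forall n \near \oo,
     `|\int[P]_w cos (u * D n w)| <= psi u + e) ->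
  psi u @[u --> +oo] --> 0 ->
  P.-negligible [set w | D n w @[n --> \oo] --> 0].
Proof.
move=> mD decay psi0.
pose B k n := [set w | `|D n w| <= k.+1%:R^-1].
have mB k n : measurable (B k n).
  have -> : B k n = (fun w => `|D n w|) @^-1` `]-oo, k.+1%:R^-1].
    by apply/seteqP; split => w /=; rewrite in_itv.
  by rewrite -[X in measurable X]setTI; apply: (measurableT_comp _ (mD n)).
pose E k m := \bigcap_(n in [set n | (m <= n)%N]) B k n.
have mE k m : measurable (E k m) by apply: bigcap_measurable => //; exists m => /=.
pose C k := \bigcup_m E k m.
have mC k : measurable (C k) by exact: bigcupT_measurable.
exists (\bigcap_k C k); split; first exact: bigcapT_measurable.
- apply/le_anti; rewrite measure_ge0 andbT; apply/lee_addgt0Pr => e e0.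
  rewrite add0e.
  (* The bound [4 / N + 4 * c] of [small_ball] is at most [e] for this [N] and for
     [c = e / 8]. *)
  pose N := (Num.trunc (8 / e)).+1.
  have NR : 0 < N%:R :> R by rewrite ltr0n.
  have Ne : 4 / N%:R <= e / 2.
    rewrite ler_pdivrMr// mulrAC ler_pdivlMr//.
    have : 8 / e < N%:R by exact: truncnS_gt.
    rewrite ltr_pdivrMr//; lra.
  have e16 : 0 < e / 16 by rewrite divr_gt0.
  have : \forall u \near +oo, psi u <= e / 16.
    move/cvgrPdist_le : psi0 => /(_ _ e16); apply: filterS => u.
    by rewrite sub0r normrN => /(le_trans (ler_norm _)).
  move=> [M [_ MP]].
  pose theta := Num.max 1 (M + 1).
  have th0 : 0 < theta by rewrite lt_max ltr01.
  have psith u : theta <= u -> psi u <= e / 16.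
    move=> tu; apply: MP; rewrite (lt_le_trans _ tu)// lt_max.
    by rewrite (_ : M < M + 1) ?orbT//; lra.
  have small : \forall n \near \oo,
      (P [set w | (`|D n w| <= (2 * N%:R * theta)^-1)%R] <= e%:E)%E.
    have : \forall n \near \oo, forall k : 'I_(N.*2),
        `|\int[P]_w cos (k.+1%:R * theta * D n w)| <= e / 8.
      apply: filter_forall => k.
      have kth : theta <= k.+1%:R * theta by rewrite ler_peMl ?ler1n// ltW.
      have := decay (k.+1%:R * theta) _ (lt_le_trans th0 kth) e16.
      by apply: filterS => n /le_trans; apply; have := psith _ kth; lra.
    apply: filterS => n bn.
    have e8 : 0 <= e / 8 by rewrite divr_ge0// ltW.
    apply: (le_trans (small_ball (mD n) (ltn0Sn _) th0 e8 bn)).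
    by rewrite lee_fin -/N; lra.
  case: small => n0 _ small.
  pose k := Num.trunc (2 * N%:R * theta).
  have kP : k.+1%:R^-1 <= (2 * N%:R * theta)^-1.
    rewrite lef_pV2 ?posrE ?ltr0n// ?mulr_gt0//.
    by apply: ltW; exact: truncnS_gt.
  apply: (@le_trans _ _ (P (C k))).
    apply: le_measure; rewrite ?inE//; first exact: bigcapT_measurable.
    exact: bigcap_inf.
  have ndE : {homo E k : m n / (m <= n)%N >-> (m <= n)%O}.
    move=> m n mn; apply/subsetPset => w Ew j /= nj; apply: Ew => /=.
    exact: leq_trans nj.
  apply: cvge_le (nondecreasing_cvg_mu (mE k) (mC k) ndE).
  apply: nearW => m /=.
  have := small (maxn n0 m) (leq_maxl _ _); apply: le_trans.
  apply: le_measure; rewrite ?inE//.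
    have -> : [set w | `|D (maxn n0 m) w| <= (2 * N%:R * theta)^-1] =
        (fun w => `|D (maxn n0 m) w|) @^-1` `]-oo, (2 * N%:R * theta)^-1].
      by apply/seteqP; split => w /=; rewrite in_itv.
    by rewrite -[X in measurable X]setTI; apply: (measurableT_comp _ (mD _)).
  by move=> w /(_ _ (leq_maxr n0 m)) /= /le_trans; apply.
- move=> w /= Dw k _.
  have k0 : 0 < k.+1%:R^-1 :> R by rewrite invr_gt0.
  move/cvgrPdist_le : Dw => /(_ _ k0) [m _ mP]; exists m => // n mn.
  by have := mP n mn; rewrite /= sub0r normrN.
Qed.

End small_balls.

(** * Approximation by simple processes *)

Section approximation.
Context {R : realType} {d : measure_display} {Omega : measurableType d}.
Variables (P : probability Omega R) (alpha : R).
Hypothesis alpha_gt0 : 0 < alpha.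

Lemma poweR_cvg0_small (T : Type) (F : set_system T) (X : T -> \bar R) :
  Filter F -> (forall t, 0 <= X t)%E -> (X t `^ alpha^-1)%E @[t --> F] --> 0%E ->
  forall e : R, 0 < e -> \forall t \near F, (X t <= e%:E)%E.
Proof.
move=> FF X0 cX e e0.
have pe : (0 < (e `^ alpha^-1)%R%:E)%E by rewrite lte_fin powR_gt0.
have nb : nbhs (0%E : \bar R) [set y | (y < (e `^ alpha^-1)%R%:E)%E].
  by apply: open_nbhs_nbhs; split; [exact: open_ereal_lt_ereal|].
apply: (@filterS _ F FF _ _ _ (cX _ nb)) => t /= Xt.
rewrite leNgt; apply: contraTN Xt => eX; rewrite -leNgt -poweR_EFin.
apply: gt0_ler_poweR; rewrite ?invr_ge0 ?(ltW alpha_gt0)//.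
- by rewrite in_itv/= lee_fin ltW//= leey.
- by rewrite in_itv/= X0 leey.
- exact: ltW.
Qed.

Lemma weak_norm_cvg0_prob (T : Type) (F : set_system T) (Z : T -> Omega -> R) :
  Filter F -> (forall t, measurable_fun setT (Z t)) ->
  weak_norm P alpha (Z t) @[t --> F] --> 0%E ->
  forall e : R, 0 < e -> \forall t \near F, (P [set w | (e < `|Z t w|)%R] <= e%:E)%E.
Proof.
move=> FF mZ cZ e e0.
pose X t := ereal_sup [set (lambda `^ alpha)%R%:E * P [set w | (lambda < `|Z t w|)%R]
  | lambda in [set lambda : R | (0 < lambda)%R]]%E.
have X0 t : (0 <= X t)%E.
  apply: (@le_trans _ _ ((1 `^ alpha)%R%:E * P [set w | (1 < `|Z t w|)%R])%E).
    by rewrite mule_ge0// lee_fin powR_ge0.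
  by apply: ereal_sup_ubound; exists 1 => //=.
have ee : 0 < e `^ alpha * e by rewrite mulr_gt0// powR_gt0.
have := poweR_cvg0_small FF X0 cZ ee; apply: filterS => t Xt.
have : ((e `^ alpha)%:E * P [set w | (e < `|Z t w|)%R] <= (e `^ alpha * e)%:E)%E.
  by apply: le_trans Xt; apply: ereal_sup_ubound; exists e.
by rewrite EFinM lee_pmul2l// lte_fin powR_gt0.
Qed.

(** The power [alpha] of [normM], which is additive in time. *)
Definition energy (I : set R) (F : R -> Omega -> R) : \bar R :=
  (\int[P]_w \int[lebesgue_measure]_(x in I) (`|F x w| `^ alpha)%R%:E)%E.

Lemma energy_ge0 I F : (0 <= energy I F)%E.
Proof. by apply: integral_ge0 => w _; apply: integral_ge0 => x _; rewrite lee_fin powR_ge0. Qed.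

Lemma measurable_tail (Z : Omega -> R) (e : R) : measurable_fun setT Z ->
  measurable [set w | e < `|Z w|].
Proof.
move=> mZ; have -> : [set w | e < `|Z w|] = (fun w => `|Z w|) @^-1` `]e, +oo[.
  by apply/seteqP; split => w /=; rewrite in_itv/= andbT.
by rewrite -[X in measurable X]setTI; apply: (measurableT_comp _ mZ).
Qed.

Section integral.
Variables (L : R -> Omega -> R).
Hypothesis L_levy : symmetric_stable_levy P alpha L.
Let FF := natural_filtration L.

Lemma itv_integral_approx a b F Z (e : R) : 0 < e ->
  is_integral_itv P alpha L FF a b F Z ->
  exists S : simple_process FF a b,
  [/\ jointly_measurable `]a, b] (sp_fun S),
      (energy `]a, b] (fun x w => sp_fun S x w - F x w)%R <= e%:E)%E &
      (P [set w | (e < `|sp_integral L S w - Z w|)%R] <= e%:E)%E].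
Proof.
move=> e0 [_ [mZ _] [S [SM Sn Sw]]].
have h1 := poweR_cvg0_small _ (fun n => energy_ge0 _ _) Sn e0.
have mSZ n : measurable_fun setT (fun w => sp_integral L (S n) w - Z w).
  by apply: measurable_funB => //; exact: (measurable_sp_integral L_levy).
have h2 := weak_norm_cvg0_prob _ mSZ Sw e0.
near \oo => n; exists (S n); split; first by have [] := SM n.
- by near: n; exact: h1.
- by near: n; exact: h2.
Unshelve. all: by end_near. Qed.

(** On every large enough interval, simple processes approximate both the
    integrand in energy and the integral in probability; the interval can be
    shared by two integrands. *)
Lemma integral_approx F Z (e : R) : 0 < e -> is_integral P alpha L FF F Z ->
  exists M : R, forall a b, a < - M -> M < b -> a < b ->
  exists S : simple_process FF a b,
  [/\ jointly_measurable `]a, b] (sp_fun S),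
      (energy `]a, b] (fun x w => sp_fun S x w - F x w)%R <= e%:E)%E &
      (P [set w | (2 * e < `|sp_integral L S w - Z w|)%R] <= (2 * e)%:E)%E].
Proof.
move=> e0 [_ [mZ _] [J [JI Jw]]].
have mJ p : p.1 < p.2 -> measurable_fun setT (J p.1 p.2).
  by move=> /JI [_ []].
pose J' p := if p.1 < p.2 then J p.1 p.2 else Z.
have mJZ (p : R * R) : measurable_fun setT (fun w => J' p w - Z w).
  by apply: measurable_funB => //; rewrite /J'; case: ifPn => // /mJ.
have cJ' : weak_norm P alpha (fun w => J' p w - Z w)
    @[p --> filter_prod (ninfty_nbhs R) (pinfty_nbhs R)] --> 0%E.
  apply: cvg_trans Jw; apply: near_eq_cvg.
  exists ([set x | x < 0], [set y | 0 < y]) => /=.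
    by split; exists 0; split => //; exact: num_real.
  by move=> [x y] /= [x0 y0]; rewrite /J' /= (lt_trans x0 y0).
have [[U V] /= [[M1 [_ MU]] [M2 [_ MV]]] UV] :=
  weak_norm_cvg0_prob _ mJZ cJ' e0.
exists (Num.max (- M1) M2) => a b; rewrite ltrNr !gt_max ltrN2.
move=> /andP[aM1 _] /andP[_ M2b] ab.
have JZ := UV (a, b) (conj (MU a aM1) (MV b M2b)).
have [S [mS Se SP]] := itv_integral_approx e0 (JI _ _ ab).
exists S; split => //.
have mSI := measurable_sp_integral L_levy S.
apply: (@le_trans _ _ (P ([set w | (e < `|sp_integral L S w - J a b w|)%R] `|`
    [set w | (e < `|J' (a, b) w - Z w|)%R]))).
  apply: le_measure; rewrite ?inE.
  - by apply: measurable_tail; exact: measurable_funB.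
  - apply: measurableU; apply: measurable_tail => //.
    by apply: measurable_funB => //; exact: (mJ (a, b)).
  move=> w /=; rewrite /J' /= ab => h.
  have [h1|h1] := ltP e `|sp_integral L S w - J a b w|; first by left.
  right; have := ler_normD (sp_integral L S w - J a b w) (J a b w - Z w).
  by rewrite addrA subrK; lra.
apply: (le_trans (measureU2 _ _ _)).
- by apply: measurable_tail; apply: measurable_funB => //; exact: (mJ (a, b)).
- exact: measurable_tail.
have -> : 2 * e = e + e by ring.
by rewrite EFinD leeD.
Qed.

End integral.
End approximation.

(** * Energy of the frozen kernel *)

Section energy_comparison.
Context {R : realType}.
Local Notation mu := (@lebesgue_measure R).

Lemma abs_integralB_le (D : set R) (f g e : R -> R) (A G : R) :
  measurable D -> measurable_fun D f -> measurable_fun D g ->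
  measurable_fun D e ->
  (forall x, D x -> 0 <= f x) -> (forall x, D x -> 0 <= g x) ->
  (forall x, D x -> `|f x - g x| <= e x) ->
  (A%:E = \int[mu]_(x in D) (f x)%:E)%E ->
  (G%:E = \int[mu]_(x in D) (g x)%:E)%E ->
  (`|A - G|%:E <= \int[mu]_(x in D) (e x)%:E)%E.
Proof.
move=> mD mf mg me f0 g0 fge fA gG.
have e0 x : D x -> 0 <= e x by move=> /fge; apply: le_trans.
have key (f' g' : R -> R) : measurable_fun D f' -> measurable_fun D g' ->
    (forall x, D x -> 0 <= f' x) -> (forall x, D x -> 0 <= g' x) ->
    (forall x, D x -> f' x <= g' x + e x) ->
    (\int[mu]_(x in D) (f' x)%:E <=
     \int[mu]_(x in D) (g' x)%:E + \int[mu]_(x in D) (e x)%:E)%E.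
  move=> mf' mg' f'0 g'0 le'; rewrite -ge0_integralD//=;
    try exact/measurable_EFinP.
  apply: ge0_le_integral => //=; first exact/measurable_EFinP.
  by apply/measurable_EFinP; exact: measurable_funD.
have h1 : (A%:E <= G%:E + \int[mu]_(x in D) (e x)%:E)%E.
  by rewrite fA gG; apply: key => // x Dx; have := fge x Dx; rewrite ler_norml; lra.
have h2 : (G%:E <= A%:E + \int[mu]_(x in D) (e x)%:E)%E.
  by rewrite fA gG; apply: key => // x Dx; have := fge x Dx; rewrite ler_norml; lra.
move: h1 h2; case: (\int[mu]_(x in D) (e x)%:E)%E => [E| |//].
  by rewrite -!EFinD !lee_fin ler_norml; lra.
by move=> _ _; rewrite leey.
Qed.

Lemma pos_powR_powR (y p q : R) : 0 < q -> `|pos_powR y p| `^ q = pos_powR y (p * q).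
Proof.
move=> q0; rewrite /pos_powR; case: ifPn => y0.
  by rewrite ger0_norm ?powR_ge0// powRrM.
by rewrite normr0 powR0// gt_eqF.
Qed.

(** After [t0] the difference of the kernels [k1] at time [t] and [k2] at time [t0]
    is [pos_powR (t - x) (q x)]. Freezing the exponent at [p] gives a function whose
    energy is explicit, and equal to [U / (p * alpha + 1)] after multiplication by
    [gamma]; this compares it with the energy of an approximation [s1 - s2]. *)
Lemma energy_comparison (alpha a t0 t b p delta v eta gamma U A : R)
    (q s1 s2 k1 k2 : R -> R) :
  let h := t - t0 in
  let kappa := expR (v * `|ln h|) - 1 + v / delta in
  let C := (1 + eta^-1) ^+ 2 in
  0 < alpha -> alpha <= 2 -> a <= t0 -> t0 < t -> t <= b ->
  0 < delta -> delta <= p -> 0 <= v -> 0 < eta -> eta < 1 ->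
  (forall x, t0 < x < t -> delta <= q x /\ `|q x - p| <= v) ->
  measurable_fun setT s1 -> measurable_fun setT s2 ->
  measurable_fun setT k1 -> measurable_fun setT k2 ->
  (forall x, t0 < x -> k1 x - k2 x = pos_powR (t - x) (q x)) ->
  `|gamma| `^ alpha = U * h `^ (- (p * alpha + 1)) -> 0 <= U ->
  (A%:E = \int[mu]_(x in `]t0, b]) (`|gamma * (s1 x - s2 x)| `^ alpha)%R%:E)%E ->
  (`|A - U / (p * alpha + 1)|%:E <=
   (3 * eta * U + 4 * C * U * kappa `^ alpha)%:E + (16 * C * `|gamma| `^ alpha)%:E *
   (\int[mu]_(x in `]a, b]) (`|s1 x - k1 x| `^ alpha)%R%:E +
    \int[mu]_(x in `]a, b]) (`|s2 x - k2 x| `^ alpha)%R%:E))%E.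
Proof.
move=> h kappa C al0 al2 at0 t0t tb d0 dp v0 eta0 eta1 qp ms1 ms2 mk1 mk2 kE gE U0 AE.
have h0 : 0 < h by rewrite subr_gt0.
have p0 : 0 < p by exact: lt_le_trans dp.
have pa0 : 0 < p * alpha by rewrite mulr_gt0.
have kap0 : 0 <= kappa.
  rewrite addr_ge0// ?divr_ge0// ?(ltW d0)// subr_ge0 -expR0 ler_expR mulr_ge0//.
have C0 : 0 <= C by exact: sqr_ge0.
set g := `|gamma| `^ alpha in gE *.
have g0 : 0 <= g by exact: powR_ge0.
pose D1 x := `|gamma * (s1 x - s2 x)| `^ alpha.
pose D2 x := g * pos_powR (t - x) (p * alpha).
pose n1 x := `|s1 x - k1 x| `^ alpha.
pose n2 x := `|s2 x - k2 x| `^ alpha.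
pose K := 4 * C * g * (h `^ p * kappa) `^ alpha.
pose e x := 3 * eta * D2 x + (16 * C * g * (n1 x + n2 x) + K * \1_(`]t0, t]%classic) x).
have K0 : 0 <= K by apply: mulr_ge0; [do 2 apply: mulr_ge0 => //|exact: powR_ge0].
have mpow (f : R -> R) : measurable_fun setT f ->
    measurable_fun setT (fun x => `|f x| `^ alpha).
  by move=> mf; apply: (measurableT_comp (measurable_powR _)); exact: measurableT_comp.
have mn1 : measurable_fun setT n1 by apply: mpow; exact: measurable_funB.
have mn2 : measurable_fun setT n2 by apply: mpow; exact: measurable_funB.
have mD1 : measurable_fun setT D1.
  by apply: mpow; apply: measurable_funM => //; exact: measurable_funB.
have mpp : measurable_fun setT (fun x : R => pos_powR (t - x) (p * alpha)).
  apply: continuous_measurable_fun => x.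
  apply: (@continuous_comp _ _ _ (fun x => t - x) (fun y => pos_powR y (p * alpha))).
    by apply: cvgB; [exact: cvg_cst|exact: cvg_id].
  exact: pos_powR_continuous.
have mD2 : measurable_fun setT D2 by exact: measurable_funM.
have D20 x : 0 <= D2 x by rewrite mulr_ge0// pos_powR_ge0.
have n10 x : 0 <= n1 x by exact: powR_ge0.
have n20 x : 0 <= n2 x by exact: powR_ge0.
have m16 : measurable_fun setT (fun x => 16 * C * g * (n1 x + n2 x)).
  by apply: measurable_funM => //; exact: measurable_funD.
have mK : measurable_fun setT (fun x : R => K * \1_(`]t0, t]%classic) x).
  by apply: measurable_funM.
have m3 : measurable_fun setT (fun x => 3 * eta * D2 x) by exact: measurable_funM.
have me : measurable_fun setT e by do 2 apply: measurable_funD => //.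
have De x : `]t0, b]%classic x -> `|D1 x - D2 x| <= e x.
  rewrite /= in_itv/= => /andP[t0x xb].
  have D2E : D2 x = `|gamma * pos_powR (t - x) p| `^ alpha.
    by rewrite normrM powRM// pos_powR_powR.
  rewrite /e -/g D2E; apply: (le_trans (powR_normB_le _ _ (ltW al0) al2 eta0 eta1)).
  rewrite -D2E lerD2l -mulrBr normrM powRM// -/g -/C.
  have step1 := powR_normD_le (s1 x - s2 x - (k1 x - k2 x))
    (k1 x - k2 x - pos_powR (t - x) p) (ltW al0) al2.
  have step2 := powR_normD_le (s1 x - k1 x) (- (s2 x - k2 x)) (ltW al0) al2.
  have -> : s1 x - s2 x - pos_powR (t - x) p =
    s1 x - s2 x - (k1 x - k2 x) + (k1 x - k2 x - pos_powR (t - x) p) by ring.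
  have E1 : s1 x - s2 x - (k1 x - k2 x) = s1 x - k1 x + - (s2 x - k2 x) by ring.
  rewrite normrN -/(n1 x) -/(n2 x) in step2.
  have step3 : `|k1 x - k2 x - pos_powR (t - x) p| `^ alpha <=
      (h `^ p * kappa) `^ alpha * \1_(`]t0, t]%classic) x.
    rewrite kE// indicE mem_setE in_itv/= t0x/= /pos_powR subr_gt0.
    have [xt|tx] := ltP x t; last first.
      by rewrite subrr normr0 powR0 ?gt_eqF// mulr_ge0 ?powR_ge0.
    have [dq qpv] := qp x (andb_true_intro (conj t0x xt)).
    rewrite (ltW xt) mulr1; apply: powR_le => //; first exact: ltW.
    by apply: powR_scaled_exponent_le => //; rewrite ?subr_gt0// /h; lra.
  have Cg0 : 0 <= C * g by rewrite mulr_ge0.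
  rewrite [leRHS](_ : _ = C * g * (16 * (n1 x + n2 x) +
      4 * ((h `^ p * kappa) `^ alpha * \1_(`]t0, t]%classic) x))); last first.
    by rewrite /K; ring.
  rewrite [leLHS]mulrA; apply: ler_wpM2l => //; rewrite -E1 in step2; lra.
have GE : ((U / (p * alpha + 1))%:E = \int[mu]_(x in `]t0, b]) (D2 x)%:E)%E.
  under eq_integral do rewrite EFinM.
  rewrite ge0_integralZl//; last 2 first.
  - by apply/measurable_EFinP; exact: measurable_funTS.
  - by move=> x _; rewrite lee_fin pos_powR_ge0.
  rewrite integral_pos_powR// -EFinM gE powRN -/h; congr EFin.
  have : h `^ (p * alpha + 1) != 0 by rewrite gt_eqF// powR_gt0.
  by move=> hn; field; rewrite hn gt_eqF//; lra.
apply: (le_trans (abs_integralB_le (D := `]t0, b]) _ (measurable_funTS mD1)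
  (measurable_funTS mD2) (measurable_funTS me) _ _ De AE GE)) => //.
  by move=> x _; exact: powR_ge0.
have sub : (`]t0, b]%classic : set R) `<=` `]a, b].
  by apply: subset_itvr; rewrite bnd_simp.
have mE (f : R -> R) D : measurable_fun setT f -> measurable_fun D (EFin \o f).
  by move=> mf; apply/measurable_EFinP; exact: measurable_funTS.
have Cg0 : 0 <= 16 * C * g by rewrite mulr_ge0// mulr_ge0.
have e10 x : 0 <= 3 * eta * D2 x by rewrite mulr_ge0// mulr_ge0// ltW.
have e20 x : 0 <= 16 * C * g * (n1 x + n2 x) by rewrite mulr_ge0// addr_ge0.
have e30 x : 0 <= K * \1_(`]t0, t]%classic) x by rewrite mulr_ge0.
have ID (f1 f2 : R -> R) : measurable_fun setT f1 -> measurable_fun setT f2 ->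
    (forall x, 0 <= f1 x) -> (forall x, 0 <= f2 x) ->
    (\int[mu]_(x in `]t0, b]) (f1 x + f2 x)%:E =
     \int[mu]_(x in `]t0, b]) (f1 x)%:E + \int[mu]_(x in `]t0, b]) (f2 x)%:E)%E.
  move=> mf1 mf2 f10 f20; under eq_integral do rewrite EFinD.
  by apply: ge0_integralD => //; (try by move=> x _; rewrite lee_fin); exact: mE.
rewrite /e ID//; last by move=> x; rewrite addr_ge0.
  2: exact: measurable_funD.
rewrite ID//.
have -> : (\int[mu]_(x in `]t0, b]) (3 * eta * D2 x)%:E =
    (3 * eta * (U / (p * alpha + 1)))%:E)%E.
  under eq_integral do rewrite EFinM.
  rewrite ge0_integralZl//; 
    [|exact: (mE _ _ mD2)|by move=> x _; rewrite lee_fin|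
     by rewrite lee_fin mulr_ge0// ltW].
  by rewrite -GE.
have -> : (\int[mu]_(x in `]t0, b]) (K * \1_(`]t0, t]%classic) x)%:E =
    (4 * C * U * kappa `^ alpha)%:E)%E.
  under eq_integral do rewrite EFinM.
  rewrite ge0_integralZl//; last by apply: mE.
  rewrite integral_indic// setIidl; last by apply: subset_itvl; rewrite bnd_simp.
  rewrite [X in (_ * X)%E](_ : _ = h%:E); last first.
    by rewrite /= lebesgue_measure_itv/= lte_fin t0t -EFinB.
  rewrite -EFinM /K powRM ?powR_ge0// -powRrM gE powRN; congr EFin.
  rewrite powRD ?powRr1 ?(ltW h0)//; last by apply/implyP => _; rewrite gt_eqF.
  have hp : h `^ (p * alpha) != 0 by rewrite gt_eqF// powR_gt0.
  by field; rewrite hp gt_eqF.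
have N12 : (\int[mu]_(x in `]t0, b]) (16 * C * g * (n1 x + n2 x))%:E <=
    (16 * C * g)%:E * (\int[mu]_(x in `]a, b]) (n1 x)%:E +
                       \int[mu]_(x in `]a, b]) (n2 x)%:E))%E.
  under eq_integral do rewrite EFinM.
  rewrite ge0_integralZl//; 
    [|by apply: mE; exact: measurable_funD|by move=> x _; rewrite lee_fin addr_ge0].
  rewrite lee_wpmul2l ?lee_fin//.
  rewrite ID//.
  apply: leeD; apply: ge0_subset_integral => //.
  - by apply/measurable_EFinP; exact: measurable_funTS.
  - by move=> x _; rewrite lee_fin.
  - by apply/measurable_EFinP; exact: measurable_funTS.
  - by move=> x _; rewrite lee_fin.
rewrite [X in (_ + X <= _)%E]addeC addeA leeD//.
rewrite -EFinD lee_fin lerD2r -[leRHS]mulr1 -!mulrA ler_wpM2l// ler_wpM2l ?(ltW eta0)//.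
by rewrite mulr1 ler_pdivrMr ?ler_peMr//; lra.
Qed.

End energy_comparison.

(** * The local exponent at a fixed time *)

Section holder_bound.
Context {R : realType} {d : measure_display} {Omega : measurableType d}.
Variables (P : probability Omega R) (alpha : R) (L H : R -> Omega -> R).
Variables (Hlo Hhi : R) (w : R -> R) (X0 X : R -> {RV P >-> R}) (t0 : R).
Hypothesis alpha_gt0 : 0 < alpha.
Hypothesis alpha_lt2 : alpha < 2.
Hypothesis L_levy : symmetric_stable_levy P alpha L.
Hypothesis H_adapted : adapted (natural_filtration L) setT H.
Hypothesis Hlo_le_Hhi : Hlo <= Hhi.
Hypothesis Hhi_lt1 : Hhi < 1.
Hypothesis H_bounds : {ae P, forall omega, forall x : R, Hlo <= H x omega <= Hhi}.
Hypothesis w_ge0 : forall h : R, 0 <= h -> 0 <= w h.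
Hypothesis w_incr : {in `[0, +oo[ &, {homo w : h k / h <= k}}.
Hypothesis H_modulus : {ae P, forall omega, forall s t : R,
     `|t - s| <= 1 -> `|H t omega - H s omega| <= w `|t - s|}.
Hypothesis Hlo_gt : alpha^-1 < Hlo.
Hypothesis w_log : w h * ln h @[h --> 0^'+] --> 0.
Hypothesis X0_integral : forall t : R,
     is_integral P alpha L (natural_filtration L)
       (multifractional_kernel alpha H t) (X0 t).
Hypothesis X_modification : forall t : R, {ae P, forall omega, X t omega = X0 t omega}.

Let FF := natural_filtration L.
Let mL := levy_measurable L_levy.
Let delta := Hlo - alpha^-1.

Let delta_gt0 : 0 < delta. Proof. by rewrite subr_gt0. Qed.
Let Hlo_pos : 0 < Hlo. Proof. by rewrite (lt_trans _ Hlo_gt)// invr_gt0. Qed.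

(** Clipping makes the bounds on the exponent at [t0] hold for every outcome,
    without losing adaptedness. *)
Let Hc (omega : Omega) := Num.max Hlo (Num.min Hhi (H t0 omega)).

Let Hc_itv omega : Hlo <= Hc omega <= Hhi.
Proof. by rewrite /Hc le_max lexx/= ge_max Hlo_le_Hhi ge_min lexx. Qed.

Let Hc_meas : meas_wrt (FF t0) Hc.
Proof.
apply/meas_wrtP; apply: measurable_maxr; first exact: measurable_cst.
apply: measurable_minr; first exact: measurable_cst.
by apply/meas_wrtP; exact: H_adapted.
Qed.

Let Hc_eq omega : (forall x : R, Hlo <= H x omega <= Hhi) -> Hc omega = H t0 omega.
Proof. by move=> /(_ t0) /andP[lo hi]; rewrite /Hc (min_idPr hi) (max_idPr lo). Qed.

Let past_measurable t (Z : Omega -> R) : meas_wrt (FF t) Z -> measurable_fun setT Z.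
Proof. by apply: meas_wrt_measurable; exact: natural_filtration_measurable. Qed.

Let kernel := multifractional_kernel alpha H.

Let kernel_diff t x omega : t0 < x -> kernel t x omega - kernel t0 x omega =
  pos_powR (t - x) (H x omega - alpha^-1).
Proof.
move=> t0x; rewrite /kernel /multifractional_kernel.
rewrite [pos_powR (t0 - x) _]/pos_powR subr_gt0 (lt_gtF t0x); ring.
Qed.

Let kernel_meas t : jointly_measurable setT (kernel t).
Proof. by have [[]] := X0_integral t. Qed.

Let section_meas (F : R -> Omega -> R) omega : jointly_measurable setT F ->
  measurable_fun setT (fun x => F x omega).
Proof.
rewrite /jointly_measurable setXTT => mF.
have mpair : measurable_fun setT (fun x : R => (omega, x)) by exact: measurable_fun_pair.
exact: (measurableT_comp mF mpair).
Qed.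

Let path_energy_meas (I : set R) (F : R -> Omega -> R) : measurable I ->
  jointly_measurable I F -> measurable_fun setT
    (fun omega => \int[lebesgue_measure]_(x in I) (`|F x omega| `^ alpha)%R%:E)%E.
Proof.
move=> mI mF; pose D : set (Omega * R) := setT `*` I.
have mD : measurable D by exact: measurableX.
pose f (p : Omega * R) := (`|F p.2 p.1| `^ alpha)%:E.
have mf : measurable_fun D f.
  apply/measurable_EFinP; apply: (measurableT_comp (measurable_powR _)).
  exact: measurableT_comp.
have mfD : measurable_fun setT (f \_ D) by apply/(measurable_restrictT f mD).
have fD0 p : (0 <= (f \_ D) p)%E.
  by rewrite patchE; case: ifPn => // _; rewrite lee_fin powR_ge0.
have := measurable_fun_fubini_tonelli_F (m2 := @lebesgue_measure R) _ mfD fD0.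
apply: eq_measurable_fun => omega _; rewrite /fubini_F [RHS]integral_mkcond.
apply: eq_integral => x _; rewrite !patchE.
have -> : (omega, x) \in D = (x \in I); last by [].
by apply/idP/idP; rewrite !inE => //= -[].
Qed.

(** The frequency [u], at the scale [h] of the increments of [X] at [t0]. *)
Let gamma (u h : R) omega := u * h `^ (- Hc omega).

Let gamma_meas u h : meas_wrt (FF t0) (gamma u h).
Proof.
apply/meas_wrtP; apply: measurable_funM; first exact: measurable_cst.
apply: (measurableT_comp (measurable_powRr h)).
by apply: measurable_funN; apply/meas_wrtP.
Qed.

(** The relative error made on ]t0, t0 + h] by freezing the exponent at [t0], as in
    [powR_scaled_exponent_le]. *)
Let kappa h := expR (w h * `|ln h|) - 1 + w h / delta.

(** The energy after [t0] of the frozen kernel, scaled by [gamma u h]; it does not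
    depend on [h], by self-similarity. *)
Let G (u : R) (omega : Omega) : R := `|u| `^ alpha / (alpha * Hc omega).

Let G_meas u : meas_wrt (FF t0) (G u).
Proof.
have -> : G u = fun omega => `|u| `^ alpha * (alpha * Hc omega) `^ (-1).
  apply/funext => omega; rewrite powR_inv1// mulr_ge0 ?(ltW alpha_gt0)//.
  by have /andP[/(lt_le_trans Hlo_pos)/ltW] := Hc_itv omega.
apply/meas_wrtP; apply: measurable_funM; first exact: measurable_cst.
apply: (measurableT_comp (measurable_powR _)).
by apply: measurable_funM; [exact: measurable_cst|apply/meas_wrtP].
Qed.

Let Hc_gt0 omega : 0 < Hc omega.
Proof. by have /andP[/(lt_le_trans Hlo_pos)] := Hc_itv omega. Qed.

Let Hc_lt1 omega : Hc omega < 1.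
Proof. by have /andP[_ /le_lt_trans] := Hc_itv omega; apply. Qed.

Let G_ge u omega : `|u| `^ alpha / alpha <= G u omega.
Proof.
rewrite /G ler_wpM2l ?powR_ge0// lef_pV2 ?posrE ?mulr_gt0//.
by rewrite -[leRHS]mulr1 ler_wpM2l ?(ltW alpha_gt0)// ltW.
Qed.

Let gamma_pow u h omega : 0 < h -> `|gamma u h omega| `^ alpha =
  `|u| `^ alpha * h `^ (- ((Hc omega - alpha^-1) * alpha + 1)).
Proof.
move=> h0; rewrite /gamma normrM powRM// (ger0_norm (powR_ge0 _ _)) -powRrM.
by rewrite mulrBl mulVf ?gt_eqF// subrK mulNr.
Qed.

Let gamma_pow_le u h omega : 0 < h -> h <= 1 ->
  `|gamma u h omega| `^ alpha <= `|u| `^ alpha * h `^ (- alpha).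
Proof.
move=> h0 h1; rewrite gamma_pow// ler_wpM2l ?powR_ge0//.
rewrite mulrBl mulVf ?gt_eqF// subrK ger_powR ?h0// lerN2.
by rewrite ler_piMl ?(ltW alpha_gt0)// ltW.
Qed.

Let gamma_le u h omega : 0 < h -> h <= 1 -> `|gamma u h omega| <= `|u| / h.
Proof.
move=> h0 h1; rewrite /gamma normrM ler_wpM2l// (ger0_norm (powR_ge0 _ _)).
by rewrite -(powR_inv1 (ltW h0)) ger_powR ?h0// lerN2 ltW.
Qed.

Let kernel_error_meas t a b (S : simple_process FF a b) :
  jointly_measurable `]a, b] (sp_fun S) ->
  jointly_measurable `]a, b] (fun x omega => sp_fun S x omega - kernel t x omega).
Proof.
move=> mS; apply: measurable_funB => //.
by apply: measurable_funS (kernel_meas t) => //; rewrite setXTT.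
Qed.

(** The approximation errors enter linearly, through their energies, with a factor
    that may blow up as [h] tends to 0: this is harmless because they are sent to 0
    first, at fixed [h]. *)
Let energy_bound u h eta a b (S1 S2 : simple_process FF a b) A :
  0 < h -> h <= 1 -> 0 < eta -> eta < 1 -> a <= t0 -> t0 + h <= b ->
  jointly_measurable `]a, b] (sp_fun S1) ->
  jointly_measurable `]a, b] (sp_fun S2) ->
  measurable_fun setT A ->
  (forall omega, ((A omega)%:E = \int[lebesgue_measure]_(x in `]t0, b])
    (`|gamma u h omega * (sp_fun S1 x omega - sp_fun S2 x omega)| `^ alpha)%R%:E)%E) ->
  (\int[P]_omega (`|A omega - G u omega|)%:E <=
   (3 * eta * `|u| `^ alpha + 4 * (1 + eta^-1) ^+ 2 * `|u| `^ alpha * kappa h `^ alpha)%:E +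
   (16 * (1 + eta^-1) ^+ 2 * (`|u| `^ alpha * h `^ (- alpha)))%:E *
   (energy P alpha `]a, b] (fun x omega => sp_fun S1 x omega - kernel (t0 + h) x omega)%R +
    energy P alpha `]a, b] (fun x omega => sp_fun S2 x omega - kernel t0 x omega)%R))%E.
Proof.
move=> h0 h1 eta0 eta1 at0 tb mS1 mS2 mA AE.
set C := (1 + eta^-1) ^+ 2; set U := `|u| `^ alpha.
pose N1 omega := (\int[lebesgue_measure]_(x in `]a, b])
  (`|sp_fun S1 x omega - kernel (t0 + h) x omega| `^ alpha)%R%:E)%E.
pose N2 omega := (\int[lebesgue_measure]_(x in `]a, b])
  (`|sp_fun S2 x omega - kernel t0 x omega| `^ alpha)%R%:E)%E.
have mN1 : measurable_fun setT N1.
  by apply: (path_energy_meas _ (kernel_error_meas (t0 + h) mS1)).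
have mN2 : measurable_fun setT N2.
  by apply: (path_energy_meas _ (kernel_error_meas t0 mS2)).
have N10 omega : (0 <= N1 omega)%E.
  by apply: integral_ge0 => x _; rewrite lee_fin powR_ge0.
have N20 omega : (0 <= N2 omega)%E.
  by apply: integral_ge0 => x _; rewrite lee_fin powR_ge0.
have E1 : energy P alpha `]a, b] (fun x omega => sp_fun S1 x omega - kernel (t0 + h) x omega)%R =
  (\int[P]_omega N1 omega)%E.
  reflexivity.
have E2 : energy P alpha `]a, b] (fun x omega => sp_fun S2 x omega - kernel t0 x omega)%R =
  (\int[P]_omega N2 omega)%E.
  reflexivity.
rewrite {}E1 {}E2.
have N1E omega : (\int[lebesgue_measure]_(x in `]a, b])
  (`|sp_fun S1 x omega - kernel (t0 + h) x omega| `^ alpha)%R%:E)%E = N1 omega by [].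
have N2E omega : (\int[lebesgue_measure]_(x in `]a, b])
  (`|sp_fun S2 x omega - kernel t0 x omega| `^ alpha)%R%:E)%E = N2 omega by [].
clearbody N1 N2.
have kap0 : 0 <= kappa h.
  have wh := w_ge0 (ltW h0).
  rewrite addr_ge0// ?divr_ge0// ?(ltW delta_gt0)// subr_ge0 -expR0 ler_expR.
  exact: mulr_ge0.
have C0 : 0 <= C by exact: sqr_ge0.
have U0 : 0 <= U by exact: powR_ge0.
have k0 : 0 <= 3 * eta * U + 4 * C * U * kappa h `^ alpha.
  apply: addr_ge0; apply: mulr_ge0 => //; try exact: powR_ge0.
    by apply: mulr_ge0 => //; exact: ltW.
  by apply: mulr_ge0 => //; exact: mulr_ge0.
have k1 : 0 <= 16 * C * (U * h `^ (- alpha)).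
  by apply: mulr_ge0; apply: mulr_ge0 => //; exact: powR_ge0.
set c0 := 3 * eta * U + _ in k0 *.
have N0 omega : (0 <= N1 omega + N2 omega)%E := adde_ge0 (N10 omega) (N20 omega).
set c1 := 16 * C * _ in k1 *.
have cN0 omega : (0 <= c1%:E * (N1 omega + N2 omega))%E.
  by apply: (mule_ge0 _ (N0 omega)); rewrite lee_fin.
have -> : (c0%:E + c1%:E * (\int[P]_omega N1 omega + \int[P]_omega N2 omega) =
  \int[P]_omega (c0%:E + c1%:E * (N1 omega + N2 omega)))%E.
  rewrite ge0_integralD//; last first.
    by apply: measurable_funeM; exact: emeasurable_funD.
  rewrite integral_cst//= [P _]probability_setT mule1; congr (_ + _)%E.
  rewrite ge0_integralZl//; last exact: emeasurable_funD.
  by rewrite ge0_integralD.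
have mGO := past_measurable (@G_meas u).
have mAG : measurable_fun setT (fun omega => (`|A omega - G u omega|)%:E).
  apply/measurable_EFinP; apply: measurableT_comp; first exact: normr_measurable.
  exact: measurable_funB.
have mcN : measurable_fun setT (fun omega => c0%:E + c1%:E * (N1 omega + N2 omega))%E.
  by apply: emeasurable_funD => //; apply: measurable_funeM; exact: emeasurable_funD.
apply: ae_ge0_le_integral => //.
  by move=> omega _; apply: (adde_ge0 _ (cN0 omega)); rewrite lee_fin.
apply: filterS2 H_bounds H_modulus => omega bd md _.
have HcH := Hc_eq bd.
have hE : t0 + h - t0 = h by ring.
have pE : (Hc omega - alpha^-1) * alpha + 1 = alpha * Hc omega.
  by rewrite mulrBl mulVf ?gt_eqF// subrK mulrC.
have EC := @energy_comparison R alpha a t0 (t0 + h) b (Hc omega - alpha^-1) delta (w h) eta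
  (gamma u h omega) U (A omega) (fun x => H x omega - alpha^-1)
  (fun x => sp_fun S1 x omega) (fun x => sp_fun S2 x omega)
  (kernel (t0 + h) ^~ omega) (kernel t0 ^~ omega).
rewrite /= hE in EC; rewrite -/(kappa h) -/C pE in EC.
have EC2 : (`|A omega - G u omega|%:E <= c0%:E +
    (16 * C * `|gamma u h omega| `^ alpha)%:E * (N1 omega + N2 omega))%E.
  rewrite -(N1E omega) -(N2E omega); apply: EC => //.
  - exact: ltW.
  - by rewrite ltrDl.
  - by rewrite /delta lerD2r; have /andP[] := Hc_itv omega.
  - exact: (w_ge0 (ltW h0)).
  - move=> x /andP[t0x xt]; split; first by rewrite /delta lerD2r; have /andP[] := bd x.
    have xh : `|x - t0| <= h by rewrite ger0_norm ?subr_ge0 ?ltW//; lra.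
    have -> : H x omega - alpha^-1 - (Hc omega - alpha^-1) = H x omega - H t0 omega.
      by rewrite HcH; ring.
    apply: (le_trans (md _ _ (le_trans xh h1))); apply: w_incr => //.
      by rewrite in_itv/= andbT.
    by rewrite in_itv/= andbT ltW.
  - exact: measurable_sp_fun.
  - exact: measurable_sp_fun.
  - exact: (section_meas omega (kernel_meas _)).
  - exact: (section_meas omega (kernel_meas _)).
  - by move=> x; exact: kernel_diff.
  - by rewrite gamma_pow// pE.
apply: (le_trans EC2); apply: leeD2l; apply: (lee_wpmul2r (N0 omega)).
rewrite lee_fin; apply: ler_wpM2l; first exact: mulr_ge0.
exact: gamma_pow_le.
Qed.

Let cos_modification u h : \int[P]_omega cos (gamma u h omega * (X (t0 + h) omega - X t0 omega)) =
  \int[P]_omega cos (gamma u h omega * (X0 (t0 + h) omega - X0 t0 omega)).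
Proof.
have mg := past_measurable (@gamma_meas u h).
congr fine; apply: ae_eq_integral => //.
- apply/measurable_EFinP/measurable_cos_comp/measurable_funM => //.
  exact: measurable_funB.
- apply/measurable_EFinP/measurable_cos_comp/measurable_funM => //.
  exact: measurable_funB.
apply: filterS2 (X_modification (t0 + h)) (X_modification t0) => omega E1 E2 _.
by rewrite E1 E2.
Qed.

(** Cosine is bounded and Lipschitz, so convergence in probability suffices. *)
Let approx_error u h e (I1 I2 : Omega -> R) : 0 < h -> h <= 1 -> 0 < e ->
  measurable_fun setT I1 -> measurable_fun setT I2 ->
  (P [set omega | (2 * e < `|I1 omega - X0 (t0 + h) omega|)%R] <= (2 * e)%:E)%E ->
  (P [set omega | (2 * e < `|I2 omega - X0 t0 omega|)%R] <= (2 * e)%:E)%E ->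
  `|\int[P]_omega cos (gamma u h omega * (X (t0 + h) omega - X t0 omega)) -
    \int[P]_omega cos (gamma u h omega * (I1 omega - I2 omega))| <=
  e * (4 * (`|u| / h) + 8).
Proof.
move=> h0 h1 e0 m1 m2 P1 P2; rewrite cos_modification.
set B1 := [set omega | _] in P1; set B2 := [set omega | _] in P2.
have mB1 : measurable B1 by apply: measurable_tail; exact: measurable_funB.
have mB2 : measurable B2 by apply: measurable_tail; exact: measurable_funB.
have mB : measurable (B1 `|` B2) by exact: measurableU.
have mg := past_measurable (@gamma_meas u h).
have mc1 : measurable_fun setT (fun omega =>
    cos (gamma u h omega * (X0 (t0 + h) omega - X0 t0 omega))).
  by apply: measurable_cos_comp; apply: measurable_funM => //; exact: measurable_funB.
have mc2 : measurable_fun setT (fun omega =>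
    cos (gamma u h omega * (I1 omega - I2 omega))).
  by apply: measurable_cos_comp; apply: measurable_funM => //; exact: measurable_funB.
have i1 := integrable_bounded P mc1 (fun omega => normr_cos_le1 _).
have i2 := integrable_bounded P mc2 (fun omega => normr_cos_le1 _).
have uh0 : 0 <= `|u| / h by rewrite divr_ge0// ltW.
rewrite -RintegralB//; pose f omega : R := 4 * e * (`|u| / h) + 2 * \1_(B1 `|` B2) omega.
have e4 : 0 <= 4 * e * (`|u| / h) by rewrite mulr_ge0// mulr_ge0// ltW.
have mf1 : measurable_fun setT (fun omega => 2 * \1_(B1 `|` B2) omega : R).
  exact: measurable_funM.
rewrite -lee_fin; apply: (@le_trans _ _ (\int[P]_omega (f omega)%:E)%E).
  apply: (abs_Rintegral_le P (M := 2)).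
  - exact: measurable_funB.
  - move=> omega; rewrite (le_trans (ler_normB _ _))//.
    have := normr_cos_le1 (gamma u h omega * (X0 (t0 + h) omega - X0 t0 omega)).
    have := normr_cos_le1 (gamma u h omega * (I1 omega - I2 omega)); lra.
  - exact: measurable_funD.
  - move=> omega; rewrite /f indicE.
    have [B12|B12] := boolP (omega \in B1 `|` B2).
      rewrite (le_trans (ler_normB _ _))//.
      have := normr_cos_le1 (gamma u h omega * (X0 (t0 + h) omega - X0 t0 omega)).
      have := normr_cos_le1 (gamma u h omega * (I1 omega - I2 omega)).
      by rewrite mulr1; lra.
    rewrite mulr0 addr0 (le_trans (cos_lipschitz _ _))// -mulrBr normrM.
    have [nB1 nB2] : ~ B1 omega /\ ~ B2 omega.
      by move: B12; rewrite notin_setE => /not_orP.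
    move/negP: nB1; rewrite -leNgt => le1; move/negP: nB2; rewrite -leNgt => le2.
    rewrite mulrC; apply: ler_pM => //; last exact: gamma_le.
    have -> : X0 (t0 + h) omega - X0 t0 omega - (I1 omega - I2 omega) =
      (I2 omega - X0 t0 omega) - (I1 omega - X0 (t0 + h) omega) by ring.
    by rewrite (le_trans (ler_normB _ _))//; lra.
rewrite /f; under eq_integral do rewrite EFinD.
rewrite ge0_integralD//=; last exact/measurable_EFinP.
rewrite (integral_cst _ _ (4 * e * (`|u| / h))%:E)//= [P _]probability_setT mule1.
under [X in (_ + X)%E]eq_integral do rewrite EFinM.
rewrite ge0_integralZl//; last first.
  by apply/measurable_EFinP; exact: measurable_indic.
rewrite integral_indic// setIT.
have PB : (P (B1 `|` B2) <= (4 * e)%:E)%E.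
  apply: (le_trans (measureU2 _ mB1 mB2)).
  have -> : 4 * e = 2 * e + 2 * e by ring.
  by rewrite EFinD leeD.
apply: (@le_trans _ _ ((4 * e * (`|u| / h))%:E + 2%:E * (4 * e)%:E)%E).
  by rewrite leeD2l// lee_wpmul2l.
by rewrite -EFinM -EFinD lee_fin; lra.
Qed.

(** The error of approximation can be made as small as desired at fixed [h], and
    only the effect of freezing the exponent remains. *)
Let cos_bound u h eta : 0 < h -> h <= 1 -> 0 < eta -> eta < 1 ->
  `|\int[P]_omega cos (gamma u h omega * (X (t0 + h) omega - X t0 omega))| <=
  expR (- (`|u| `^ alpha / alpha)) + (3 * eta * `|u| `^ alpha +
    4 * (1 + eta^-1) ^+ 2 * `|u| `^ alpha * kappa h `^ alpha).
Proof.
move=> h0 h1 eta0 eta1; apply/ler_addgt0Pr => e e0.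
pose M := 16 * (1 + eta^-1) ^+ 2 * (`|u| `^ alpha * h `^ (- alpha)).
have M0 : 0 <= M.
  apply: mulr_ge0; apply: mulr_ge0 => //; try exact: powR_ge0.
  exact: sqr_ge0.
have uh0 : 0 <= `|u| / h by rewrite divr_ge0// ltW.
pose eps := e / (2 * M + (4 * (`|u| / h) + 8)).
have den0 : 0 < 2 * M + (4 * (`|u| / h) + 8) by lra.
have eps0 : 0 < eps by rewrite divr_gt0.
have epsE : eps * (2 * M + (4 * (`|u| / h) + 8)) = e.
  by rewrite /eps divfK// gt_eqF.
have XI t : is_integral P alpha L FF (kernel t) (X0 t) := X0_integral t.
have [M1 A1] := integral_approx alpha_gt0 L_levy eps0 (XI (t0 + h)).
have [M2 A2] := integral_approx alpha_gt0 L_levy eps0 (XI t0).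
pose b := Num.max (t0 + h) (Num.max M1 M2) + 1.
pose a := Num.min t0 (Num.min (- M1) (- M2)) - 1.
have [tb M1b M2b] : [/\ t0 + h < b, M1 < b & M2 < b].
  by split; rewrite ltr_pwDr// !le_max lexx ?orbT.
have [at0 aM1 aM2] : [/\ a < t0, a < - M1 & a < - M2].
  by split; rewrite ltrBlDr ltr_pwDr// !ge_min lexx ?orbT.
have t0b : t0 < b by rewrite (le_lt_trans _ tb)// lerDl ltW.
clearbody a b.
have ab : a < b by exact: lt_trans t0b.
have [S1 [mS1 E1 P1]] := A1 a b aM1 M1b ab.
have [S2 [mS2 E2 P2]] := A2 a b aM2 M2b ab.
have c0 : 0 <= `|u| `^ alpha / alpha by rewrite divr_ge0 ?powR_ge0// ltW.
have [A [mA AE Abound]] := simple_diff_cos_bound L_levy S1 S2 (ltW at0) (ltW t0b)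
  (@gamma_meas u h) (@G_meas u) c0 (G_ge u).
have := energy_bound h0 h1 eta0 eta1 (ltW at0) (ltW tb) mS1 mS2 mA AE.
rewrite -/M => EB.
have mI1 := measurable_sp_integral L_levy S1.
have mI2 := measurable_sp_integral L_levy S2.
have err := approx_error u h0 h1 eps0 mI1 mI2 P1 P2.
set I := \int[P]_omega _; set J := \int[P]_omega _ in Abound err.
have JB : `|J| <= expR (- (`|u| `^ alpha / alpha)) + (3 * eta * `|u| `^ alpha +
    4 * (1 + eta^-1) ^+ 2 * `|u| `^ alpha * kappa h `^ alpha + M * (eps + eps)).
  rewrite -lee_fin; apply: (le_trans Abound); rewrite [leRHS]EFinD.
  apply: leeD2l; apply: (le_trans EB); rewrite [leRHS]EFinD.
  apply: leeD2l; rewrite [leRHS]EFinM; apply: lee_wpmul2l; first by rewrite lee_fin.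
  rewrite [leRHS]EFinD; exact: (leeD E1 E2).
have IJ : `|I| <= `|I - J| + `|J| by rewrite -[X in `|X| <= _](subrK J) ler_normD.
move: epsE err JB IJ; rewrite -/I => epsE err JB IJ.
have -> : e = eps * (2 * M) + eps * (4 * (`|u| / h) + 8) by rewrite -epsE; ring.
by lra.
Qed.

(** The factor [ln h] is at least 1 in norm near 0, so [w h] is at most
    [w h * ln h] in norm. *)
Let w_cvg0 : w h @[h --> 0^'+] --> 0.
Proof.
apply/cvgrPdist_le => e e0; move/cvgrPdist_le : w_log => /(_ _ e0) wl.
have small : \forall h \near (0 : R)^'+, h <= expR (-1) :> R.
  by apply: nbhs_right_ltW; exact: expR_gt0.
near=> h; have h0 : 0 < h by [].
have he : h <= expR (-1) by near: h.
have lnh : ln h <= -1 by rewrite -(expRK (-1)) ler_ln// posrE// expR_gt0.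
have : `|0 - w h * ln h| <= e by near: h.
rewrite !sub0r !normrN normrM; apply: le_trans.
by rewrite ler_peMr// ler0_norm; lra.
Unshelve. all: by end_near. Qed.

Let kappa_cvg0 : kappa h @[h --> 0^'+] --> 0.
Proof.
have c1 : w h * `|ln h| @[h --> 0^'+] --> 0.
  apply/cvgrPdist_le => e e0; move/cvgrPdist_le : w_log => /(_ _ e0).
  by apply: filterS => h; rewrite !sub0r !normrN !normrM normr_id.
have c2 : expR (w h * `|ln h|) @[h --> 0^'+] --> (1 : R).
  by rewrite -expR0; apply: continuous_cvg => //; exact: continuous_expR.
have c3 : w h / delta @[h --> 0^'+] --> (0 : R).
  by rewrite -[X in _ --> X](mul0r delta^-1); apply: cvgM => //; exact: cvg_cst.
have c4 : (1 : R) @[_ --> (0 : R)^'+] --> (1 : R) by exact: cvg_cst.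
have cD := cvgD (cvgB c2 c4) c3; rewrite subrr add0r in cD.
exact: cD.
Qed.

Let cos_limit u e : 0 < e -> \forall h \near 0^'+,
  `|\int[P]_omega cos (gamma u h omega * (X (t0 + h) omega - X t0 omega))| <=
  expR (- (`|u| `^ alpha / alpha)) + e.
Proof.
move=> e0; pose U := `|u| `^ alpha; have U0 : 0 <= U by exact: powR_ge0.
pose eta := Num.min 2^-1 (e / (6 * (U + 1))).
have den : 0 < 6 * (U + 1) by lra.
have eta0 : 0 < eta by rewrite lt_min invr_gt0 ltr0n/= divr_gt0.
have eta1 : eta < 1 by rewrite gt_min; apply/orP; left; lra.
have etaU : 3 * eta * U <= e / 2.
  have : eta * (6 * (U + 1)) <= e by rewrite -ler_pdivlMr// ge_min lexx orbT.
  by have := mulr_ge0 (ltW eta0) U0; lra.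
pose K := 4 * (1 + eta^-1) ^+ 2 * U.
have K0 : 0 <= K by apply: mulr_ge0 => //; apply: mulr_ge0 => //; exact: sqr_ge0.
have kc : K * pos_powR (kappa h) alpha @[h --> 0^'+] --> 0.
  have cp : pos_powR (kappa h) alpha @[h --> 0^'+] --> (0 : R).
    have p0 : pos_powR 0 alpha = 0 :> R by rewrite /pos_powR ltxx.
    have := pos_powR_continuous alpha_gt0 (x := 0); rewrite /continuous_at p0.
    by apply: cvg_comp; exact: kappa_cvg0.
  have cK : K @[_ --> (0 : R)^'+] --> K by exact: cvg_cst.
  have cM := cvgM cK cp; rewrite mulr0 in cM; exact: cM.
have e2 : 0 < e / 2 by rewrite divr_gt0.
move/cvgrPdist_le : kc => /(_ _ e2) kc.
have small : \forall h \near (0 : R)^'+, h <= 1 :> R by apply: nbhs_right_ltW; exact: ltr01.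
near=> h; have h0 : 0 < h by [].
have h1 : h <= 1 by near: h.
apply: (le_trans (cos_bound u h0 h1 eta0 eta1)); rewrite lerD2l.
have : `|0 - K * pos_powR (kappa h) alpha| <= e / 2 by near: h.
rewrite sub0r normrN => /(le_trans (ler_norm _)).
have wh := w_ge0 (ltW h0).
have kap0 : 0 <= kappa h.
  rewrite addr_ge0// ?divr_ge0// ?(ltW delta_gt0)// subr_ge0 -expR0 ler_expR.
  exact: mulr_ge0.
have -> : pos_powR (kappa h) alpha = kappa h `^ alpha.
  rewrite /pos_powR; case: ltP => // k0.
  have -> : kappa h = 0 by apply/le_anti; rewrite k0 kap0.
  by rewrite powR0// gt_eqF.
by rewrite -/U -/K; lra.
Unshelve. all: by end_near. Qed.

(** One sequence of scales is enough, and keeps the exceptional set a countable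
    combination of events. *)
Let D n omega := harmonic n `^ (- Hc omega) * (X (t0 + harmonic n) omega - X t0 omega).

Let scaled_increment_not_cvg0 : P.-negligible [set omega | D n omega @[n --> \oo] --> 0].
Proof.
pose psi (u : R) : R := expR (- (`|u| `^ alpha / alpha)).
apply: (@negligible_cvg0 _ _ _ P D psi).
- move=> n; apply: measurable_funM; last exact: measurable_funB.
  apply: (measurableT_comp (measurable_powRr _)); apply: measurable_funN.
  exact: (past_measurable Hc_meas).
- move=> u e u0 e0; have := cos_limit u e0.
  move=> [r /= r0 rP]; move/cvgrPdist_lt : (@cvg_harmonic R) => /(_ _ r0).
  apply: filterS => n hn.
  have := rP (harmonic n) hn (harmonic_gt0 n).
  congr (`|_| <= _); apply: eq_Rintegral => omega _.
  by rewrite /gamma /D mulrA.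
have c1 : `|u| `^ alpha / alpha @[u --> +oo] --> +oo.
  apply/cvgryPge => A; near=> u.
  have u0 : 0 <= u by near: u; exact: nbhs_pinfty_ge.
  rewrite ger0_norm// ler_pdivlMr//.
  have Au : (`|A * alpha| + 1) `^ alpha^-1 <= u by near: u; exact: nbhs_pinfty_ge.
  have := powR_le (ltW alpha_gt0) (powR_ge0 _ _) Au.
  rewrite -powRrM mulVf ?gt_eqF// powRr1 ?addr_ge0//; apply: le_trans.
  by rewrite (le_trans (ler_norm _))// lerDl.
exact: (cvg_comp _ _ c1 (@cvgr_expR R)).
Unshelve. all: by end_near. Qed.

(** An exponent [rho] above [Hc] in the definition of the Holder exponent bounds the
    increment over [h] by [h `^ rho], and [h `^ (rho - Hc)] tends to 0. *)
Let scaled_increment_cvg0 omega :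
  ((Hc omega)%:E < holder_exponent (fun t => X t omega) t0)%E ->
  D n omega @[n --> \oo] --> 0.
Proof.
move=> /ereal_sup_gt[_ [rho [rho0 lim0] <-]]; rewrite lte_fin => Hrho.
have : (lime_sup (fun h => (`|X (t0 + h) omega - X t0 omega| / `|h| `^ rho)%:E) 0 < 1)%E.
  by rewrite lim0 lte_fin.
rewrite lime_supE => /ereal_inf_lt[_ [r r0 <-]] supr.
move: r0; rewrite /= in_itv/= andbT => r0.
have s0 : 0 < rho - Hc omega by rewrite subr_gt0.
have hc : harmonic n `^ (rho - Hc omega) @[n --> \oo] --> (0 : R).
  have := (cvg_at_rightP (fun a : R => a `^ (rho - Hc omega)) 0 0).1 (powR_cvg0 s0).
  by apply; split; [exact: harmonic_gt0|exact: cvg_harmonic].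
apply: (@squeeze_cvgr _ _ _ _ (fun n => - harmonic n `^ (rho - Hc omega))
  (fun n => harmonic n `^ (rho - Hc omega))) => //; last first.
  by rewrite -oppr0; apply: cvgN.
near=> n; rewrite -ler_norml.
have hn0 : 0 < harmonic n :> R by exact: harmonic_gt0.
have hnr : harmonic n < r.
  near: n; move/cvgrPdist_lt : (@cvg_harmonic R) => /(_ _ r0).
  by apply: filterS => m; rewrite sub0r normrN (ger0_norm (harmonic_ge0 m)).
have : ((`|X (t0 + harmonic n) omega - X t0 omega| / `|harmonic n| `^ rho)%:E < 1%:E)%E.
  apply: le_lt_trans supr; apply: ereal_sup_ubound; exists (harmonic n) => //.
  split; first by rewrite /ball/= sub0r normrN gtr0_norm.
  by apply/eqP; rewrite gt_eqF.
rewrite lte_fin (gtr0_norm hn0) ltr_pdivrMr ?powR_gt0// mul1r => /ltW le.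
have -> : rho - Hc omega = - Hc omega + rho by ring.
rewrite /D normrM (ger0_norm (powR_ge0 _ _)) powRD; last first.
  by apply/implyP => _; rewrite gt_eqF.
by rewrite ler_wpM2l ?powR_ge0.
Unshelve. all: by end_near. Qed.

Lemma holder_exponent_le : {ae P, forall omega,
  (holder_exponent (fun t => X t omega) t0 <= (H t0 omega)%:E)%E}.
Proof.
have nD : {ae P, forall omega, ~ (D n omega @[n --> \oo] --> 0)}.
  apply: negligibleS scaled_increment_not_cvg0 => omega /=; exact: contrapT.
apply: filterS2 H_bounds nD => omega bd; rewrite -(Hc_eq bd) leNgt.
by move=> nc; apply/negP => /scaled_increment_cvg0.
Qed.

End holder_bound.

Theorem theorem3p3 (R : realType) (d : measure_display)
    (Omega : measurableType d) (P : probability Omega R)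
    (alpha : R) (L : R -> Omega -> R) (H : R -> Omega -> R)
    (Hlo Hhi : R) (w : R -> R) (X0 X : R -> {RV P >-> R})
  (alpha_gt0 : 0 < alpha) (alpha_lt2 : alpha < 2)
  (L_levy : symmetric_stable_levy P alpha L)
  (H_meas : jointly_measurable setT H)
  (H_adapted : adapted (natural_filtration L) setT H)
  (Hlo_gt0 : 0 < Hlo) (Hlo_le_Hhi : Hlo <= Hhi) (Hhi_lt1 : Hhi < 1)
  (H_bounds : {ae P, forall omega, forall x : R, Hlo <= H x omega <= Hhi})
  (w_ge0 : forall h : R, 0 <= h -> 0 <= w h)
  (w_cont : {within `[0, +oo[, continuous w})
  (w_incr : {in `[0, +oo[ &, {homo w : h k / h <= k}})
  (w_0 : w 0 = 0)
  (H_modulus : {ae P, forall omega, forall s t : R,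
     `|t - s| <= 1 -> `|H t omega - H s omega| <= w `|t - s|})
  (Hlo_gt : alpha^-1 < Hlo)
  (w_log : w h * ln h @[h --> 0^'+] --> 0)
  (X0_integral : forall t : R,
     is_integral P alpha L (natural_filtration L)
       (multifractional_kernel alpha H t) (X0 t))
  (X_modification : forall t : R, {ae P, forall omega, X t omega = X0 t omega})
  (X_cont : forall omega : Omega, continuous (fun t => X t omega)) :
  forall t0 : R, {ae P, forall omega,
    (holder_exponent (fun t => X t omega) t0 <= (H t0 omega)%:E)%E}.
Proof.
move=> t0; exact: (holder_exponent_le t0 alpha_gt0 alpha_lt2 L_levy H_adapted
  Hlo_le_Hhi Hhi_lt1 H_bounds w_ge0 w_incr H_modulus Hlo_gt w_log X0_integral
  X_modification).
Qed.
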